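(* Let $\mathcal{T}$ be a locally finite rooted tree with no leaves, fix a family of total linear orders $\{<_v\}_{v\in V(\mathcal{T})}$ where $<_v$ is an order on the children of the vertex $v$, and let $V_{\mathcal{T}}$ be the associated Higman-Thompson group. Let $H$ be a finitely generated subgroup of $V_{\mathcal{T}}$. Then the action of $H$ on $\partial\mathcal{T}$ has a finite orbit or admits a ping-pong pair.
   Context: Let $\mathcal{T}$ be a locally finite rooted tree with no leaves, with root $v_0$, edges directed away from $v_0$, and vertex set $V(\mathcal{T})$. The boundary $\partial\mathcal{T}$ is the set of one-sided infinite directed paths $\xi=(\xi_n)_{n\ge 0}$ of vertices starting at $\xi_0=v_0$. It carries the visual metric $d(\xi,\xi')=2^{-N(\xi,\xi')}$ for $\xi\neq\xi'$, where $N(\xi,\xi')$ is the smallest integer $n$ with $\xi_n\neq\xi'_n$ (and $d(\xi,\xi)=0$). With this metric $\partial\mathcal{T}$ is compact and totally disconnected, with a basis of clopen balls $\partial\mathcal{T}_v=\{\xi\in\partial\mathcal{T}\mid v\text{ is in }\xi\}$, $v\in V(\mathcal{T})$. An almost automorphism of $\mathcal{T}$ is a homeomorphism $g$ of $\partial\mathcal{T}$ for which there exist a partition of $\partial\mathcal{T}$ into finitely many clopen balls $D_1,\dots,D_n$ and positive numbers $\lambda_1,\dots,\lambda_n$ such that $d(g(y),g(z))=\lambda_j d(y,z)$ for all $y,z\in D_j$ and all $j$. Such a partition is called admissible for $g$. The group of almost automorphisms is denoted $\mathrm{AAut}(\mathcal{T})$. The family $\{<_v\}$ induces a linear order $<$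 on $\partial\mathcal{T}$: for $\xi\neq\xi'$ and $n=N(\xi,\xi')$, declare $\xi<\xi'$ if $\xi_n<_{\xi_{n-1}}\xi'_n$. An element $g\in\mathrm{AAut}(\mathcal{T})$ is a Higman-Thompson element if there is an admissible partition $\mathcal{P}$ for $g$ such that $g|_D$ is order-preserving for all $D\in\mathcal{P}$. The Higman-Thompson group $V_{\mathcal{T}}$ associated to $\mathcal{T}$ (and the chosen orders) is the subgroup of $\mathrm{AAut}(\mathcal{T})$ consisting of all Higman-Thompson elements. A ping-pong pair for an action of a group $H$ by homeomorphisms on a compact space $X$ consists of $g,h\in H$ for which there exist pairwise disjoint open sets $U_1,U_2,V_1,V_2\subset X$ with $g(X\setminus U_1)\subseteq V_1$ and $h(X\setminus U_2)\subseteq V_2$. *)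

(* Defs.v *)
From HB Require Import structures.
From mathcomp Require Import all_boot all_order all_algebra.
From mathcomp Require Import all_classical all_reals all_analysis.

Set Implicit Arguments.
Unset Strict Implicit.
Unset Printing Implicit Defensive.

Import Order.TTheory GRing.Theory Num.Theory.

Local Open Scope classical_set_scope.

Section Homeo.
Variable X : topologicalType.

Record homeo := Homeo {
  homeo_fun :> X -> X;
  homeo_inv : X -> X;
  homeo_funK : cancel homeo_fun homeo_inv;
  homeo_invK : cancel homeo_inv homeo_fun;
  homeo_continuous : continuous homeo_fun;
  homeo_inv_continuous : continuous homeo_inv }.

Lemma homeo_eqP (g h : homeo) : g =1 h -> g = h.
Proof.
case: g h => [f f' fK f'K cf cf'] [k k' kK k'K ck ck'] /= /funext fk.
subst k; have ff' : f' = k'.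
  by apply/funext => x; rewrite -[in LHS](k'K x) fK.
by subst k'; congr Homeo; exact: Prop_irrelevance.
Qed.

HB.instance Definition _ := gen_eqMixin homeo.
HB.instance Definition _ := gen_choiceMixin homeo.

Definition homeo_one : homeo :=
  @Homeo id id (frefl _) (frefl _) (fun x => cvg_id) (fun x => cvg_id).

Definition homeo_symm (g : homeo) : homeo :=
  Homeo (@homeo_invK g) (@homeo_funK g)
    (@homeo_inv_continuous g) (@homeo_continuous g).

Definition homeo_mul (g h : homeo) : homeo :=
  @Homeo (g \o h) (homeo_inv h \o homeo_inv g)
    (can_comp (@homeo_funK g) (@homeo_funK h))
    (can_comp (@homeo_invK h) (@homeo_invK g))
    (fun x => continuous_comp (@homeo_continuous h x)
                              (@homeo_continuous g (h x)))
    (fun x => continuous_comp (@homeo_inv_continuous g x)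
                              (@homeo_inv_continuous h (homeo_inv g x))).

Lemma homeo_mulA : associative homeo_mul.
Proof. by move=> f g h; exact: homeo_eqP. Qed.
Lemma homeo_mul1l : left_id homeo_one homeo_mul.
Proof. by move=> f; exact: homeo_eqP. Qed.
Lemma homeo_mul1r : right_id homeo_one homeo_mul.
Proof. by move=> f; exact: homeo_eqP. Qed.
Lemma homeo_mulVl : left_inverse homeo_one homeo_symm homeo_mul.
Proof. by move=> f; apply: homeo_eqP => x; exact: homeo_funK. Qed.
Lemma homeo_mulVr : right_inverse homeo_one homeo_symm homeo_mul.
Proof. by move=> f; apply: homeo_eqP => x; exact: homeo_invK. Qed.

HB.instance Definition _ := isGroup.Build homeo
  homeo_mulA homeo_mul1l homeo_mul1r homeo_mulVl homeo_mulVr.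

End Homeo.

Definition subgroup (G : groupType) (H : set G) : Prop :=
  group_closed [in H].

Definition finitely_generated (G : groupType) (H : set G) : Prop :=
  exists2 S : set G, finite_set S & H = smallest (@subgroup G) S.

Section Actions.
Variables (X : topologicalType) (H : set (homeo X)).

Definition orbit_under (x : X) : set X := [set g x | g in H].

Definition has_finite_orbit : Prop := exists x : X, finite_set (orbit_under x).

Definition ping_pong_pair (g h : homeo X) : Prop :=
  exists U1 U2 V1 V2 : set X,
    [/\ [/\ open U1, open U2, open V1 & open V2],
        [/\ [disjoint U1 & U2], [disjoint U1 & V1] & [disjoint U1 & V2]],
        [/\ [disjoint U2 & V1], [disjoint U2 & V2] & [disjoint V1 & V2]],
        g @` (~` U1) `<=` V1
      & h @` (~` U2) `<=` V2].

Definition has_ping_pong_pair : Prop :=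
  exists g h : homeo X, [/\ H g, H h & ping_pong_pair g h].

End Actions.

(* A rooted tree with edges directed away from the root: every vertex is the
   endpoint of exactly one directed path issued from the root. *)
Record rootedTree := RootedTree {
  vertex :> choiceType;
  tree_root : vertex;
  edge : rel vertex;
  tree_pathP : forall v, exists! p : seq vertex,
    path edge tree_root p /\ last tree_root p = v }.

Definition locally_finite (T : rootedTree) : Prop :=
  forall v : T, finite_set [set w | edge v w].

Definition no_leaves (T : rootedTree) : Prop :=
  forall v : T, exists w, edge v w.

Definition strict_linear_order_on (A : Type) (S : set A) (lt : rel A) : Prop :=
  [/\ forall x, S x -> ~~ lt x x,
      forall y x z, S x -> S y -> S z -> lt x y -> lt y z -> lt x z
    & forall x y, S x -> S y -> x <> y -> lt x y \/ lt y x].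

Definition children_orders (T : rootedTree) (lt : T -> rel T) : Prop :=
  forall v : T, strict_linear_order_on [set w | edge v w] (lt v).

Record ray (T : rootedTree) := Ray {
  ray_vertex :> nat -> T;
  ray_root : ray_vertex 0 = tree_root T;
  ray_edge : forall n, edge (ray_vertex n) (ray_vertex n.+1) }.

HB.instance Definition _ (T : rootedTree) := gen_eqMixin (ray T).
HB.instance Definition _ (T : rootedTree) := gen_choiceMixin (ray T).

Section Divergence.
Variable T : rootedTree.
Implicit Types x y z : ray T.

Lemma rayP x y : x =1 y -> x = y.
Proof.
case: x y => [x x0 xe] [y y0 ye] /= /funext xy.
by subst y; congr Ray; exact: Prop_irrelevance.
Qed.

Lemma ray_neqP x y : x <> y -> exists n, x n != y n.
Proof.
move=> xy; apply: contrapT => nn; apply: xy; apply: rayP => n.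
by apply/eqP; apply: contrapT => /negP ne; apply: nn; exists n.
Qed.

(* The least n with x n != y n, and the junk value 0 when x = y. *)
Definition divergence x y : nat :=
  if pselect (exists n, x n != y n) is left e then ex_minn e else 0.

Lemma divergence_neq x y : x <> y ->
  x (divergence x y) != y (divergence x y).
Proof.
move=> /ray_neqP e; rewrite /divergence; case: pselect => // e'.
by case: ex_minnP.
Qed.

Lemma divergence_min x y n : x n != y n -> divergence x y <= n.
Proof.
move=> xy; rewrite /divergence; case: pselect => [e|[]]; last by exists n.
by case: ex_minnP => m _ /(_ _ xy).
Qed.

Lemma divergenceC x y : divergence x y = divergence y x.
Proof.
have [->//|xy] := pselect (x = y); have yx : y <> x by move=> e; exact: xy.
apply/eqP; rewrite eqn_leq; apply/andP; split; apply: divergence_min.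
  by rewrite eq_sym divergence_neq.
by rewrite eq_sym divergence_neq.
Qed.

End Divergence.

(* The boundary of T. The parameter R only fixes the field of real numbers in
   which the visual metric takes its values. *)
Definition boundary (R : realType) (T : rootedTree) : Type := ray T.

HB.instance Definition _ (R : realType) (T : rootedTree) :=
  Choice.on (boundary R T).

Section Boundary.
Variables (R : realType) (T : rootedTree).
Local Notation bT := (boundary R T).
Local Open Scope ring_scope.

Definition visual_dist (x y : bT) : R :=
  if x == y then 0 else 2 ^- divergence x y.

Lemma visual_distxx x : visual_dist x x = 0.
Proof. by rewrite /visual_dist eqxx. Qed.

Lemma visual_dist_positivity x y : visual_dist x y = 0 -> x = y.
Proof.
rewrite /visual_dist; case: eqP => // _ /eqP.
by rewrite invr_eq0 expf_eq0 pnatr_eq0 andbF.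
Qed.

Lemma visual_dist_sym x y : visual_dist x y = visual_dist y x.
Proof. by rewrite /visual_dist eq_sym divergenceC. Qed.

Lemma visual_dist_triangle y x z :
  visual_dist x z <= visual_dist x y + visual_dist y z.
Proof.
have d0 a b : 0 <= visual_dist a b.
  by rewrite /visual_dist; case: ifP => // _; rewrite invr_ge0 exprn_ge0.
have le_d (a b : bT) n : a n != b n -> 2 ^- n <= visual_dist a b.
  move=> ab; rewrite /visual_dist; case: eqP => [e|_].
    by rewrite e eqxx in ab.
  by rewrite lef_pV2 ?posrE ?exprn_gt0// ler_weXn2l ?ler1n// divergence_min.
rewrite {1}/visual_dist; case: eqP => [_|xz]; first exact: addr_ge0.
have := divergence_neq xz; set n := divergence x z => nxz.
have [xy|xy] := eqVneq (x n) (y n).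
  by rewrite (le_trans (le_d y z n _)) ?lerDr// -xy.
by rewrite (le_trans (le_d x y n _)) ?lerDl.
Qed.

HB.instance Definition _ := isMetric.Build R bT
  visual_distxx visual_dist_positivity visual_dist_sym visual_dist_triangle.

Definition boundary_ball (v : T) : set bT := [set x | exists n, x n = v].

Definition admissible (g : bT -> bT) (P : set (set bT)) : Prop :=
  [/\ finite_set P,
      partition P id setT,
      P `<=` range boundary_ball
    & forall D, P D -> exists2 lambda : R, 0 < lambda
        & forall y z, D y -> D z -> mdist (g y) (g z) = lambda * mdist y z].

Definition AAut : set (homeo bT) := [set g | exists P, admissible g P].

Variable lt : T -> rel T.

(* All rays start at the root, so the divergence of distinct rays is positive
   and the predecessor below is not truncated. *)
Definition boundary_lt (x y : bT) : Prop :=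
  let n := divergence x y in x <> y /\ lt (x n.-1) (x n) (y n).

Definition order_preserving_on (D : set bT) (g : bT -> bT) : Prop :=
  forall x y, D x -> D y -> boundary_lt x y -> boundary_lt (g x) (g y).

Definition higman_thompson : set (homeo bT) :=
  [set g | AAut g /\
    exists2 P, admissible g P & forall D, P D -> order_preserving_on D g].

End Boundary.

(* Main.v *)
(** Suppose that H has no finite orbit.  An order-preserving similarity of a ball
    onto itself is the identity.  Hence in a minimal closed H-invariant set K the
    images of a ball cannot all stay small, since otherwise its maximal images would
    be finitely many balls permuted by H and their points would have finite orbits.
    By finite generation some ball meeting K can therefore be mapped into every open
    set meeting K.  Applied to a cyclic group, this shows that every omega-limit set
    of an element g contains a periodic point, which is neutral, attracting or
    repelling; so a power of g fixes an open set Z pointwise and contracts the rest,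
    away from finitely many repelling points, towards finitely many attracting ones.
    Conjugates of such elements with neutral sets of empty intersection compose to
    an element contracting everything, provided the attracting points of one avoid
    the repelling points of the next, which is arranged by B. H. Neumann's
    separation argument.  Separating translates of the resulting attracting and
    repelling points yield the ping-pong pair. *)

Require Import Defs.
From mathcomp Require Import all_boot all_order all_algebra.
From mathcomp Require Import all_classical all_reals all_analysis.
From mathcomp Require Import zify.

Set Implicit Arguments.
Unset Strict Implicit.
Unset Printing Implicit Defensive.

Local Open Scope classical_set_scope.

(** * Rays and cylinders *)

Section Cylinders.
Variable T : rootedTree.
Implicit Types x y z : ray T.

Lemma ray_path x n :
  path (@edge T) (tree_root T) (mkseq (fun i => x i.+1) n) /\
  last (tree_root T) (mkseq (fun i => x i.+1) n) = x n.
Proof.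
elim: n => [|n [IHp IHl]]; first by rewrite /= ray_root.
by rewrite mkseqS rcons_path last_rcons IHl IHp ray_edge.
Qed.

(** Both initial segments are directed paths from the root to one vertex, so [tree_pathP] identifies
    them. Hence a vertex determines its level and its ancestors on every ray through it. *)
Lemma ray_path_unique x y m n : x m = y n ->
  mkseq (fun i => x i.+1) m = mkseq (fun i => y i.+1) n.
Proof.
move=> xy; have [p [_ pu]] := tree_pathP (x m).
rewrite -(pu _ (ray_path x m)) -(pu (mkseq (fun i => y i.+1) n)) // xy.
exact: ray_path.
Qed.

Lemma ray_vertex_level x y m n : x m = y n -> m = n.
Proof. by move=> /ray_path_unique/(congr1 size); rewrite !size_mkseq. Qed.

Lemma ray_vertex_agree x y m n : m <= n -> x n = y n -> x m = y m.
Proof.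
case: m => [|m] mn; first by rewrite !ray_root.
move=> /ray_path_unique/(congr1 (nth (x 0) ^~ m)).
by rewrite !nth_mkseq.
Qed.

Lemma divergence_gt x y n : x <> y -> (n < divergence x y) = (x n == y n).
Proof.
move=> xy; apply/idP/eqP => [|xyn].
  by rewrite ltnNge => nd; apply/eqP/negPn; apply: contra nd; exact: divergence_min.
rewrite ltnNge; apply/negP => dn.
by move/eqP: (divergence_neq xy); apply; exact: ray_vertex_agree xyn.
Qed.

Lemma divergence_gt0 x y : x <> y -> 0 < divergence x y.
Proof. by move=> xy; rewrite divergence_gt // !ray_root. Qed.

Definition cyl x n : set (ray T) := [set y | y n = x n].

Definition cylinder (D : set (ray T)) : Prop := exists x n, D = cyl x n.

Lemma cyl_self x n : cyl x n x. Proof. by []. Qed.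

Lemma cyl_eq x y n : cyl x n y -> cyl y n = cyl x n.
Proof. by rewrite /cyl /= => ->. Qed.

Lemma cyl_sub x m n : m <= n -> cyl x n `<=` cyl x m.
Proof. by move=> mn y /= /(ray_vertex_agree mn). Qed.

Lemma cylinder_cyl x n : cylinder (cyl x n). Proof. by exists x, n. Qed.

Lemma cylinderP D x : cylinder D -> D x -> exists n, D = cyl x n.
Proof. by move=> [y [n ->]] Dx; exists n; rewrite (cyl_eq Dx). Qed.

Hypothesis lfT : locally_finite T.

(* Koenig's lemma: a cylinder without finite subcover has a child without finite
   subcover, and following such children gives an uncovered ray. *)
Lemma cylinder_cover (n : ray T -> nat) :
  exists s : seq (ray T), forall y, exists2 x, x \in s & cyl x (n x) y.
Proof.
pose good v := exists s : seq (ray T),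
  forall y k, y k = v -> exists2 x, x \in s & cyl x (n x) y.
suff : good (tree_root T).
  by move=> [s sP]; exists s => y; apply: (sP y 0); rewrite ray_root.
apply: contrapT => bad0.
have step v : exists w, ~ good v -> edge v w /\ ~ good w.
  have [gv|bv] := pselect (good v); first by exists v.
  apply: contrapT => nw; apply: bv.
  have gw w : edge v w -> good w.
    by move=> vw; apply: contrapT => bw; apply: nw; exists w.
  have [c cE] : exists c : seq T, [set w | edge v w] = [set` c].
    by apply/finite_seqP; exact: lfT.
  have : forall w, w \in c -> good w.
    by move=> w wc; apply: gw; have : [set` c] w by []; rewrite -cE.
  move: c {nw gw} cE => c cE gc.
  suff [s sP] : exists s : seq (ray T), forall y k, y k \in c ->
      exists2 x, x \in s & cyl x (n x) y.
    exists s => y k ykv; apply: (sP y k.+1).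
    suff : [set` c] (y k.+1) by [].
    by rewrite -cE /= -ykv; exact: ray_edge.
  elim: c gc {cE} => [|w c IH] gc; first by exists [::].
  have [s1 s1P] := gc w (mem_head _ _).
  have [w' w'c|s2 s2P] := IH; first by apply: gc; rewrite inE w'c orbT.
  exists (s1 ++ s2) => y k; rewrite inE => /orP[/eqP/s1P|/s2P] [x xs yx];
  by exists x => //; rewrite mem_cat xs ?orbT.
have [f fP] := choice step.
have bad k : ~ good (iter k f (tree_root T)).
  by elim: k => //= k IH; have [] := fP _ IH.
have fe k : edge (iter k f (tree_root T)) (iter k.+1 f (tree_root T)).
  by have [] := fP _ (bad k).
pose x := @Ray T (fun k => iter k f (tree_root T)) erefl fe.
apply: (bad (n x)); exists [:: x] => y k yk.
exists x; first exact: mem_head.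
have yx : y k = x (n x) by [].
have kn := ray_vertex_level yx; rewrite kn in yx; exact: yx.
Qed.

(** Compactness for monotone bounds: the maximum of the local bounds over a finite subcover serves
    everywhere. *)
Lemma uniform_bound (Q : ray T -> nat -> Prop) :
  (forall x, exists n m, forall y, cyl x n y -> Q y m) ->
  (forall y m m', m <= m' -> Q y m -> Q y m') -> exists M, forall y, Q y M.
Proof.
move=> /choice[n /choice[m mP]] Qle.
have [s sP] := cylinder_cover n.
exists (\max_(x <- s) m x) => y; have [x xs /mP] := sP y.
by apply: Qle; exact: leq_bigmax_seq.
Qed.

(** A cover by cylinders of constant level [n] is finite, so the rays pass through finitely many
    vertices at that level. *)
Lemma level_pigeonhole (u : nat -> ray T) n : exists i j, i < j /\ u i n = u j n.
Proof.
have [s sP] := cylinder_cover (fun=> n).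
apply: contrapT => nij.
have inj : injective (fun i => u i n).
  move=> i j uij; case: (ltngtP i j) => // ij; exfalso; apply: nij.
    by exists i, j.
  by exists j, i.
have := @uniq_leq_size _ (mkseq (fun i => u i n) (size s).+1) (map (fun x : ray T => x n) s).
rewrite mkseq_uniq // size_mkseq size_map ltnn => h; suff: false by [].
apply: h => // _ /mapP[i _ ->]; have [x xs ux] := sP (u i).
by rewrite ux; apply/mapP; exists x.
Qed.

End Cylinders.

(** * Order-preserving similarities *)

Section HomeoGroup.
Variable X : topologicalType.
Implicit Types (g h : homeo X) (x : X) (D : set X).
Local Open Scope group_scope.

Lemma homeoME g h x : (g * h) x = g (h x).
Proof. by []. Qed.

Lemma homeoKV g : cancel g (g^-1)%g.
Proof. exact: homeo_funK. Qed.

Lemma homeoVK g : cancel (g^-1)%g g.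
Proof. exact: homeo_invK. Qed.

Lemma homeo_inj g : injective g.
Proof. exact: can_inj (homeoKV g). Qed.

Lemma homeo_image_comp g h D :
  (g * h) @` D = g @` (h @` D).
Proof. by rewrite image_comp. Qed.

Lemma homeo_image_inv g D :
  (g^-1)%g @` (g @` D) = D.
Proof. by rewrite -homeo_image_comp mulVg image_id. Qed.

End HomeoGroup.

Section OrderSimilarities.
Local Open Scope group_scope.
Variables (R : realType) (T : rootedTree) (lt : T -> rel T).
Hypothesis ltT : children_orders lt.
Local Notation X := (boundary R T).
Local Notation blt := (@boundary_lt R T lt).
Implicit Types (x y z : X) (g h : homeo X) (D E : set X).

(** Here [n] is the last level of agreement, one below the divergence; this form avoids the
    predecessor. *)
Lemma boundary_ltP x y : blt x y <->
  exists n, [/\ x n = y n, x n.+1 <> y n.+1 & lt (x n) (x n.+1) (y n.+1)].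
Proof.
split=> [[xy]|[n [xyn xyn1 ltxy]]].
  have d0 := divergence_gt0 xy; exists (divergence x y).-1; rewrite prednK //.
  split=> //; last exact/eqP/divergence_neq.
  by apply/eqP; rewrite -divergence_gt // prednK.
have xy : x <> y by move=> e; rewrite e in xyn1.
have -> : boundary_lt lt x y = (x <> y /\ lt (x (divergence x y).-1)
  (x (divergence x y)) (y (divergence x y))) by [].
suff -> : divergence x y = n.+1 by [].
apply/eqP; rewrite eqn_leq divergence_min ?divergence_gt //=; exact/eqP.
Qed.

Lemma boundary_lt_trans y x z : blt x y -> blt y z -> blt x z.
Proof.
move=> /boundary_ltP[m [xym xym1 ltxy]] /boundary_ltP[n [yzn yzn1 ltyz]].
have [irr tr _] := ltT (x m).
have [mn|nm|mn] := ltngtP m n.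
- have e := ray_vertex_agree mn yzn; have e' := ray_vertex_agree (ltnW mn) yzn.
  by apply/boundary_ltP; exists m; rewrite -e -e'.
- have e := ray_vertex_agree nm xym; have e' := ray_vertex_agree (ltnW nm) xym.
  by apply/boundary_ltP; exists n; rewrite e e'.
- subst n; have xz : lt (x m) (x m.+1) (z m.+1).
    have ey : edge (x m) (y m.+1) by rewrite xym; exact: ray_edge.
    have ez : edge (x m) (z m.+1) by rewrite xym yzn; exact: ray_edge.
    by apply: (tr _ _ _ (ray_edge x m) ey ez ltxy); rewrite xym.
  apply/boundary_ltP; exists m; split=> //; first by rewrite xym.
  move=> e; have := irr (x m.+1) (ray_edge x m).
  by rewrite {2}e xz.
Qed.

Lemma boundary_lt_total x y : x <> y -> blt x y \/ blt y x.
Proof.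
move=> xy; have [n dn] : exists n, divergence x y = n.+1.
  by exists (divergence x y).-1; rewrite prednK // divergence_gt0.
have e : x n = y n by apply/eqP; rewrite -divergence_gt // dn.
have /eqP ne := divergence_neq xy; rewrite dn in ne.
have [_ _ tot] := ltT (x n).
have ey : edge (x n) (y n.+1) by rewrite e; exact: ray_edge.
have [lxy|lyx] := tot _ _ (ray_edge x n) ey ne; [left|right];
  apply/boundary_ltP; exists n; split => //; last by rewrite -e.
by move=> e'; apply: ne; rewrite e'.
Qed.

(** Cylinders are order-convex: if [b] left the common segment of [a] and [c] before level [n], its
    first vertex off that segment would be both above and below their common vertex at that
    level. *)
Lemma boundary_lt_convex a b c n : blt a b -> b = c \/ blt b c ->
  a n = c n -> a n = b n.
Proof.
move=> + [<-//|]; move=> /boundary_ltP[m [abm abm1 ltab]].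
move=> /boundary_ltP[p [bcp bcp1 ltbc]] acn.
have [nm|mn] := leqP n m; first exact: ray_vertex_agree nm abm.
have ac1 := ray_vertex_agree mn acn; have ac := ray_vertex_agree (ltnW mn) acn.
have pm : p = m.
  apply/eqP; rewrite eqn_leq; apply/andP; split; rewrite leqNgt; apply/negP => h.
    by apply: abm1; rewrite ac1 (ray_vertex_agree h bcp).
  by apply: bcp1; apply: (ray_vertex_agree h); rewrite -abm.
subst p; have [irr tr _] := ltT (a m).
have eb : edge (a m) (b m.+1) by rewrite abm; exact: ray_edge.
have := irr _ (ray_edge a m); rewrite (tr _ _ _ (ray_edge a m) eb) //.
  exact: ray_edge.
by rewrite abm ac1.
Qed.

(* A ratio of distances is a power of 2, recorded as the difference of the
   exponents q and p; on a one-point set p and q are arbitrary. *)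
Definition order_similarity g D : Prop :=
  (exists p q, forall y z, D y -> D z -> y <> z ->
     divergence (g y) (g z) + q = divergence y z + p) /\
  order_preserving_on lt D g.

(** A similarity may send a cylinder onto a clopen set that is not a cylinder, so the image is
    constrained separately. *)
Definition good g D : Prop := [/\ cylinder D, cylinder (g @` D) & order_similarity g D].

Lemma good_comp g h D : good h D -> good g (h @` D) -> good (g * h) D.
Proof.
move=> [bD bh [[p [q pq]] oh]] [_ bg [[p' [q' pq']] og]].
split; [by []|by rewrite homeo_image_comp|].
split; last first.
  move=> x y Dx Dy xy; by apply: (og (h x) (h y)); [exists x|exists y|exact: oh].
exists (p + p')%N, (q + q')%N => y z Dy Dz yz.
have hyz : h y <> h z by move/homeo_inj.
have := pq _ _ Dy Dz yz.
have := pq' (h y) (h z); rewrite !homeoME => h1 h2.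
have : (divergence (g (h y)) (g (h z)) + q' = divergence (h y) (h z) + p')%N.
  by apply: h1.
lia.
Qed.

Lemma good_inv g D : good g D -> good g^-1 (g @` D).
Proof.
move=> [bD bg [[p [q pq]] og]]; split; [by []|by rewrite homeo_image_inv|].
split.
  exists q, p => _ _ [y Dy <-] [z Dz <-] yz; rewrite !homeoKV.
  by rewrite (pq y z Dy Dz) // => e; apply: yz; rewrite e.
move=> _ _ [y Dy <-] [z Dz <-] yz; rewrite !homeoKV.
have ne : y <> z.
  by move=> e; move: yz; rewrite e => -[].
have [//|zy] := boundary_lt_total ne.
have [nn _] := boundary_lt_trans yz (og _ _ Dz Dy zy).
by exfalso; apply: nn.
Qed.

Lemma good_sub g D E : good g D -> cylinder E -> E `<=` D -> good g E.
Proof.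
move=> [bD bg [[p [q pq]] og]] bE ED; split => //; last first.
  split; last by move=> x y /ED ? /ED; exact: og.
  by exists p, q => y z /ED ? /ED; exact: pq.
have [DE|nDE] := pselect (D `<=` E).
  by have -> : E = D by exact/seteqP.
(* The pair [x], [z] pins down the exponents: it yields [N < m + p - q], so the subtraction is not
   truncated and the cylinder of that level about [g x] lies in the image of [D]. *)
have [z Dz nEz] : exists2 z, D z & ~ E z.
  by apply: contrapT => nz; apply: nDE => z Dz; apply: contrapT => nEz; apply: nz; exists z.
have [x [m Em]] := bE; have Dx : D x by apply: ED; rewrite Em.
have gDx : (g @` D) (g x) by exists x.
have [N gN] := cylinderP bg gDx.
have xz : x <> z by move=> e; apply: nEz; rewrite -e Em.
have gdiv u v : u <> v -> (g u : X) <> g v by move=> uv /homeo_inj.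
have xzm : divergence x z <= m.
  rewrite leqNgt divergence_gt //; apply/negP => /eqP e; apply: nEz.
  by rewrite Em /cyl /= -e.
have gxz : N < divergence (g x) (g z).
  have : (g @` D) (g z) by exists z.
  by rewrite gN /cyl /= => e; rewrite divergence_gt ?e //; exact: gdiv.
have exz := pq _ _ Dx Dz xz.
have key y : D y -> E y <-> cyl (g x) (m + p - q) (g y).
  move=> Dy; have [<-|xy] := pselect (x = y); first by rewrite Em.
  have exy := pq _ _ Dx Dy xy.
  have -> : E y <-> m < divergence x y.
    by rewrite divergence_gt // Em /cyl /= eq_sym; split => /eqP.
  have -> : cyl (g x) (m + p - q) (g y) <-> (m + p - q < divergence (g x) (g y))%N.
    by rewrite divergence_gt; [rewrite /cyl /= eq_sym; split => /eqP | exact: gdiv].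
  by split; lia.
exists (g x), (m + p - q)%N; apply/seteqP; split=> [_ [y Ey <-]|w gxw].
  by apply/key => //; exact: ED.
have : (g @` D) w by rewrite gN; apply: cyl_sub gxw; lia.
by case=> y Dy gyw; exists y => //; apply/key; rewrite ?gyw.
Qed.

Hypothesis lfT : locally_finite T.

(* Off the fixed points, iteration gives a strictly monotone sequence with constant
   consecutive distances, against the finiteness of the levels of the tree. *)
Lemma rigid g D x : good g D -> g @` D = D -> D x -> g x = x.
Proof.
move=> [bD _ [[p [q pq]] og]] gD Dx; apply: contrapT => gxx.
have gDD y : D y -> D (g y) by move=> Dy; rewrite -gD; exists y.
have gne u v : u <> v -> (g u : X) <> g v by move=> uv /homeo_inj.
pose P n := `[< exists y z, [/\ D y, D z, y <> z & divergence y z = n] >].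
have exP : exists n, P n.
  exists (divergence (g x) x); apply/asboolP; exists (g x), x.
  by split => //; exact: gDD.
(* Since [g] permutes [D], take a pair of least divergence: its image pair gives [q <= p], its
   preimage pair [p <= q]. *)
have pqE : p = q.
  case: (ex_minnP exP) => n /asboolP[y [z [Dy Dz yz dyz]]] nmin.
  have h1 : n <= divergence (g y) (g z).
    apply: nmin; apply/asboolP; exists (g y), (g z); split => //; try exact: gDD.
    exact: gne.
  have := pq _ _ Dy Dz yz.
  have : exists2 y', D y' & g y' = y.
    by have : (g @` D) y by rewrite gD.
  have : exists2 z', D z' & g z' = z.
    by have : (g @` D) z by rewrite gD.
  move=> [z' Dz' gz'] [y' Dy' gy'].
  have yz' : y' <> z' by move=> e; apply: yz; rewrite -gy' -gz' e.
  have h2 : n <= divergence y' z'.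
    by apply: nmin; apply/asboolP; exists y', z'.
  have := pq _ _ Dy' Dz' yz'; rewrite gy' gz'; lia.
pose u i : X := iter i g x.
have Du i : D (u i) by elim: i => //= i; exact: gDD.
have une i : u i.+1 <> u i by elim: i => //= i; exact: gne.
have udiv i : divergence (u i.+1) (u i) = divergence (g x) x.
  elim: i => //= i IH; have := pq _ _ (Du i.+1) (Du i) (une i).
  by rewrite pqE IH => /addIn.
(* Two terms agree at the level where consecutive terms differ. By monotonicity [u i.+1] lies
   between them or equals [u j], so convexity makes it agree with [u i] there, a contradiction. *)
have [i [j [ij uij]]] := level_pigeonhole lfT u (divergence (g x) x).
have : u i (divergence (g x) x) != u i.+1 (divergence (g x) x).
  by rewrite -(udiv i) eq_sym; exact: divergence_neq.
move=> /eqP; apply.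
have [gt|gt] := boundary_lt_total gxx; last first.
  have uS k : blt (u k) (u k.+1).
    by elim: k => //= k IH; apply: og => //; exact: (Du k.+1).
  apply: boundary_lt_convex uij => //.
  rewrite -(subnKC ij); elim: (j - i.+1)%N => [|k IH]; first by rewrite addn0; left.
  right; rewrite addnS; case: IH => [->|]; first exact: uS.
  by move/boundary_lt_trans; apply; exact: uS.
have uS k : blt (u k.+1) (u k).
  by elim: k => //= k IH; apply: og => //; exact: (Du k.+1).
have : u j = u i.+1 \/ blt (u j) (u i.+1).
  rewrite -(subnKC ij); elim: (j - i.+1)%N => [|k IH]; first by rewrite addn0; left.
  right; rewrite addnS; case: IH => [<-|]; first exact: uS.
  by apply: boundary_lt_trans; exact: uS.
case=> [<-//|lt1]; rewrite uij; apply: boundary_lt_convex lt1 _ _.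
  by right; exact: uS.
by rewrite uij.
Qed.

End OrderSimilarities.

(** * The visual topology and local form of Higman-Thompson elements *)

Section VisualTopology.
Import Order.TTheory GRing.Theory Num.Theory.
Variables (R : realType) (T : rootedTree).
Local Notation X := (boundary R T).
Implicit Types (x y z : X).

Lemma nbhs_cylP x (P : set X) : nbhs x P <-> exists n, cyl x n `<=` P.
Proof.
have mdistE y : x <> y -> mdist x y = (2 ^- divergence x y)%R :> R.
  by move=> xy; rewrite /mdist /= /visual_dist; case: eqP.
split=> [/nbhs_ballP[e /= e0 eP]|[n nP]].
  exists (Num.bound e^-1); apply: subset_trans eP => y xy.
  rewrite ballEmdist /=; have [<-|ne] := pselect (x = y); first by rewrite mdistxx.
  rewrite mdistE // invf_plt ?posrE ?exprn_gt0 //.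
  apply/upper_nthrootP/ltnW; rewrite divergence_gt // eq_sym; exact/eqP.
apply/nbhs_ballP; exists (2 ^- n)%R; first by rewrite /= invr_gt0 exprn_gt0.
move=> y; rewrite ballEmdist /= => xy; apply: nP.
have [<-//|ne] := pselect (x = y).
move: xy; rewrite mdistE // ltf_pV2 ?posrE ?exprn_gt0 // ltr_eXn2l ?ltr1n //.
by rewrite divergence_gt // /cyl /= => /eqP.
Qed.

Lemma open_cylP (U : set X) :
  open U <-> forall x, U x -> exists n, cyl x n `<=` U.
Proof.
rewrite openE; split=> UP x Ux; first exact/nbhs_cylP/UP.
exact/nbhs_cylP/UP.
Qed.

Lemma homeo_cyl (g : homeo X) x n : exists m, g @` cyl x m `<=` cyl (g x) n.
Proof.
have /nbhs_cylP[m mP] : nbhs x (g @^-1` cyl (g x) n).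
  by apply: (@homeo_continuous _ g); apply/nbhs_cylP; exists n.
by exists m => _ [y /mP ? <-].
Qed.

Lemma boundary_ball_vertex x n : @boundary_ball R T (x n) = cyl x n.
Proof.
apply/seteqP; split => [y [k ykx]|y]; last by exists n.
by have kn := ray_vertex_level ykx; rewrite kn in ykx.
Qed.

Variable lt : T -> rel T.

(** The admissible ball [D] about [x] has an open image; a cylinder in [D] deep enough for its
    target cylinder to lie in that image is mapped onto the target. *)
Lemma higman_thompson_good (g : homeo X) x : higman_thompson lt g ->
  exists n, forall m, n <= m -> good lt g (cyl x m).
Proof.
move=> [_ [P [_ [covP _ _] ballP simP] ordP]].
have [D PD Dx] : exists2 D, P D & D x.
  by have : (cover P id) x by rewrite covP.
have [v _ vD] := ballP D PD.
have [k xk] : (boundary_ball v) x by rewrite vD.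
have cD : D = cyl x k by rewrite -vD -xk boundary_ball_vertex.
have [lam lam0 lamP] := simP D PD.
have mdistE y z : y <> z -> mdist y z = (2 ^- divergence y z)%R :> R.
  by move=> yz; rewrite /mdist /= /visual_dist; case: eqP.
have gne y z : y <> z -> (g y : X) <> g z by move=> yz /homeo_inj.
have [p [q pq]] : exists p q, forall y z, D y -> D z -> y <> z ->
    divergence (g y) (g z) + q = divergence y z + p.
  have [[y0 [z0 [Dy0 Dz0 yz0]]]|n0] := pselect (exists y z, [/\ D y, D z & y <> z]);
    last by exists 0, 0 => y z Dy Dz yz; exfalso; apply: n0; exists y, z.
  (* One reference pair encodes the ratio [lam] by its divergences after and before applying [g]. *)
  exists (divergence (g y0) (g z0)), (divergence y0 z0) => y z Dy Dz yz.
  have e := lamP y z Dy Dz; have e0 := lamP y0 z0 Dy0 Dz0.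
  move: e e0; rewrite !mdistE //; try exact: gne.
  move=> e e0; have e2 (n : nat) : (2 ^+ n != 0 :> R)%R by rewrite expf_neq0 // pnatr_eq0.
  have : (2 ^+ (divergence (g y) (g z) + divergence y0 z0) =
          2 ^+ (divergence y z + divergence (g y0) (g z0)) :> R)%R.
    apply: invr_inj; rewrite !exprD !invfM e e0; by rewrite mulrCA mulrA mulrC.
  by by apply: ieexprIn; rewrite ?ltr0n ?pnatr_eq1.
have [M MP] : exists M, cyl (g x) M `<=` g @` D.
  apply/nbhs_cylP; have -> : g @` D = homeo_inv g @^-1` D.
    apply/seteqP; split => [_ [y Dy <-]|y Dy]; first by rewrite /= homeo_funK.
    by exists (homeo_inv g y) => //; rewrite homeo_invK.
  apply: (@homeo_inv_continuous _ g); rewrite homeo_funK; apply/nbhs_cylP.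
  by exists k; rewrite cD.
(* Level [k] ensures containment in [D]; [M + q] makes [m + p - q] at least [M], hence untruncated,
   with target cylinder inside the image of [D]. *)
exists (k + M + q) => m km.
have sub : cyl x m `<=` D by rewrite cD; apply: cyl_sub; lia.
have Dm : g @` cyl x m = cyl (g x) (m + p - q).
  have key y : D y -> cyl x m y <-> cyl (g x) (m + p - q) (g y).
    move=> Dy; have [<-//|xy] := pselect (x = y).
    have exy := pq _ _ Dx Dy xy.
    have -> : cyl x m y <-> m < divergence x y.
      by rewrite divergence_gt // /cyl /= eq_sym; split => /eqP.
    have -> : cyl (g x) (m + p - q) (g y) <-> (m + p - q < divergence (g x) (g y))%N.
      by rewrite divergence_gt; [rewrite /cyl /= eq_sym; split => /eqP | exact: gne].
    by split; lia.
  apply/seteqP; split => [_ [y ym <-]|w gxw]; first by apply/key => //; exact: sub.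
  have : (g @` D) w by apply: MP; apply: cyl_sub gxw; lia.
  by case=> y Dy gyw; exists y => //; apply/key; rewrite ?gyw.
split; [exact: cylinder_cyl | by rewrite Dm; exact: cylinder_cyl | split].
  by exists p, q => y z /sub Dy /sub; exact: pq.
by move=> y z /sub Dy /sub Dz; exact: ordP PD y z Dy Dz.
Qed.

End VisualTopology.

(** * Minimal sets *)

Section Subgroups.
Local Open Scope group_scope.
Variables (G : groupType) (H : set G).
Hypothesis sgH : subgroup H.

Lemma subgroup1 : H 1.
Proof. by have [/set_mem] := sgH. Qed.

Lemma subgroupV g : H g -> H g^-1.
Proof. by move=> Hg; apply/set_mem/(group_closedV sgH)/mem_set. Qed.

Lemma subgroupM g h : H g -> H h -> H (g * h).
Proof. by move=> Hg Hh; apply/set_mem/(group_closedM sgH); apply/mem_set. Qed.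

Lemma subgroupX g n : H g -> H (g ^+ n).
Proof.
move=> Hg; elim: n => [|n IH]; first by rewrite expg0; exact: subgroup1.
by rewrite expgS; exact: subgroupM.
Qed.

End Subgroups.

Lemma subgroupP (G : groupType) (H : set G) :
  H 1%g -> (forall g h, H g -> H h -> H (g * h)%g) ->
  (forall g, H g -> H g^-1%g) ->
  subgroup H.
Proof.
move=> H1 HM HV; split; first exact/mem_set.
by move=> g h /set_mem Hg /set_mem Hh; apply/mem_set/HM => //; exact: HV.
Qed.

Lemma smallest_subgroup (G : groupType) (S : set G) :
  subgroup (smallest (@subgroup G) S).
Proof.
apply: subgroupP => [A [sA _]|g h gS hS A AS|g gS A AS]; first exact: subgroup1.
  by apply: subgroupM; [exact: AS.1|exact: gS|exact: hS].
by apply: subgroupV; [exact: AS.1|exact: gS].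
Qed.

Section MinimalSets.
Local Open Scope group_scope.
Variables (R : realType) (T : rootedTree).
Local Notation X := (boundary R T).
Implicit Types (x y z : X) (K C : set X) (g h : homeo X) (H : set (homeo X)).

Lemma closed_cylP C : closed C <->
  forall x, (forall n, exists2 y, C y & cyl x n y) -> C x.
Proof.
split=> cC x Cx; apply: cC.
  by move=> B /nbhs_cylP[n nB]; have [y Cy yx] := Cx n; exists y; split => //; exact: nB.
by move=> n; have [|y [Cy xy]] := Cx (cyl x n); [apply/nbhs_cylP; exists n|exists y].
Qed.

Lemma not_closed_cyl C x : closed C -> ~ C x -> exists n, cyl x n `<=` ~` C.
Proof.
move=> /closed_cylP cC nCx; apply: contrapT => nn; apply: nCx; apply: cC => n.
apply: contrapT => ny; apply: nn; exists n => y xy Cy; apply: ny; by exists y.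
Qed.

Definition invariant_under H C := forall h x, H h -> C x -> C (h x).

(** Minimality is encoded as density in [K] of the orbit of each of its points. *)
Definition minimal_set H K := [/\ K !=set0, closed K, invariant_under H K
  & forall x y n, K x -> K y -> exists2 h, H h & cyl y n (h x)].

Hypothesis lfT : locally_finite T.

(** If the intersection were empty, finitely many cylinders, each missing a member of the chain,
    would cover the boundary; the smallest of these members would then be empty. *)
Lemma chain_meet (A : set (set X)) : A !=set0 ->
  (forall C, A C -> C !=set0 /\ closed C) ->
  (forall C D, A C -> A D -> C `<=` D \/ D `<=` C) ->
  \bigcap_(C in A) C !=set0.
Proof.
move=> [C0 AC0] Acl Atot; apply: contrapT => n0.
have step x : exists Cn : set X * nat, A Cn.1 /\ cyl x Cn.2 `<=` ~` Cn.1.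
  have [C AC nCx] : exists2 C, A C & ~ C x.
    apply: contrapT => nC; apply: n0; exists x => C AC.
    by apply: contrapT => nCx; apply: nC; exists C.
  by have [n nC] := not_closed_cyl (Acl C AC).2 nCx; exists (C, n).
have [f fP] := choice step.
have [s sP] := cylinder_cover lfT (fun x => (f x).2).
have [C AC Cs] : exists2 C, A C & forall x, x \in s -> C `<=` (f x).1.
  elim: s {sP} => [|x s [C AC Cs]]; first by exists C0.
  have [Cx|xC] := Atot C (f x).1 AC (fP x).1.
    by exists C => // y; rewrite inE => /orP[/eqP->|/Cs].
  exists (f x).1; first exact: (fP x).1.
  by move=> y; rewrite inE => /orP[/eqP->//|/Cs]; exact: subset_trans.
have [[y Cy] _] := Acl C AC; have [x xs xy] := sP y.
exact: (fP x).2 xy (Cs x xs y Cy).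
Qed.

Lemma minimal_set_exists H C : subgroup H -> C !=set0 -> closed C ->
  invariant_under H C -> exists2 K, minimal_set H K & K `<=` C.
Proof.
move=> sgH C0 cC iC.
pose P K := [/\ K !=set0, closed K, invariant_under H K & K `<=` C].
have PC : P C by split; first exact: C0.
pose Rel (K L : {K | P K}) := `[< sval L `<=` sval K >].
have [||||[K [K0 cK iK KC]] Kmin] := @Zorn {K | P K} Rel.
- by move=> K; exact/asboolP.
- by move=> L K M /asboolP KL /asboolP LM; apply/asboolP; exact: subset_trans LM KL.
- move=> [K PK] [L PL] /asboolP KL /asboolP LK; apply: eq_exist => /=.
  exact/seteqP.
- move=> A Atot; have [A0|nA] := pselect (A !=set0); last first.
    by exists (exist _ C PC) => K AK; exfalso; apply: nA; exists K.
  have [|||x xA] := @chain_meet [set sval K | K in A].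
  + by move: A0 => [K AK]; exists (sval K), K.
  + by move=> _ [[K [K0 cK iK KC]] AK <-].
  + move=> _ _ [K AK <-] [L AL <-].
    by have [/asboolP|/asboolP] := Atot _ _ AK AL; [right|left].
  have PB : P (\bigcap_(K in A) sval K).
    split.
    * by exists x => K AK; apply: xA; exists K.
    * apply: closed_bigI => K _; by case: (svalP K).
    * by move=> h y Hh yA K AK; case: (svalP K) => _ _ iK _; apply: iK => //; exact: yA.
    * move: A0 => [K AK] y yA; case: (svalP K) => _ _ _; apply; exact: yA.
  exists (exist _ _ PB) => K AK; apply/asboolP => /= y; exact.
exists K => //; split => // x y n Kx Ky.
(* The orbit closure of [x] is a nonempty closed invariant subset of [K], so Zorn maximality for
   reverse inclusion gives [L = K]. *)
pose L := [set z | forall n, exists2 h, H h & cyl z n (h x)].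
suff PL : P L.
  have /(congr1 sval) /= LK : exist _ L PL = exist _ K (And4 K0 cK iK KC).
    apply: Kmin; apply/asboolP => /= z Lz.
    have /closed_cylP cK' := cK; apply: cK' => m; have [h Hh hz] := Lz m.
    by exists (h x) => //; exact: iK.
  by have : L y by rewrite LK.
split.
- by exists x => m; exists 1 => //; exact: subgroup1.
- apply/closed_cylP => z Lz m; have [w Lw wz] := Lz m; have [h Hh hw] := Lw m.
  by exists h => //; rewrite /cyl /= hw.
- move=> h z Hh Lz m; have [p hp] := homeo_cyl h z m; have [k Hk kz] := Lz p.
  exists (h * k); first exact: subgroupM.
  by apply: hp; exists (k x).
- move=> z Lz; apply: (KC); have /closed_cylP cK' := cK; apply: cK' => m.
  by have [h Hh hz] := Lz m; exists (h x) => //; exact: (iK h x Hh Kx).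
Qed.

(** Density brings each point of [K] into [E], continuity extends this to a cylinder, and
    compactness leaves finitely many elements. *)
Lemma minimal_set_cover H K E : subgroup H -> minimal_set H K -> open E ->
  (exists2 y, K y & E y) -> exists s : seq (homeo X),
  (forall h, h \in s -> H h) /\ forall x, K x -> exists2 h, h \in s & E (h x).
Proof.
move=> sgH [_ cK iK denseK] /open_cylP oE [y Ky Ey].
have step x : exists hn : homeo X * nat, H hn.1 /\
    forall z, cyl x hn.2 z -> K z -> E (hn.1 z).
  have [Kx|nKx] := pselect (K x); last first.
    have [n nK] := not_closed_cyl cK nKx; exists (1, n); split; first exact: subgroup1.
    by move=> z /nK.
  have [n nE] := oE y Ey; have [h Hh hx] := denseK x y n Kx Ky.
  have [m hm] := homeo_cyl h x n; exists (h, m); split => // z xz _; apply: nE.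
  by have := hm (h z); rewrite (cyl_eq hx); apply; exists z.
have [f fP] := choice step.
have [s sP] := cylinder_cover lfT (fun x => (f x).2).
exists (map (fun x => (f x).1) s); split => [_ /mapP[x _ ->]|x Kx].
  exact: (fP x).1.
have [z zs zx] := sP x; exists (f z).1; first exact: map_f.
exact: (fP z).2.
Qed.

Definition finite_orbit H x := finite_set (orbit_under H x).

(** If [y] were isolated in [K], one of finitely many [k] would send each orbit point [h y] to [y]
    itself, leaving only the values [k^-1 y]. *)
Lemma minimal_set_nonisolated H K y n : subgroup H -> minimal_set H K -> K y ->
  ~ finite_orbit H y -> exists z, [/\ K z, cyl y n z & z <> y].
Proof.
move=> sgH mK Ky infy; apply: contrapT => nz; apply: infy.
have [||s [sH sP]] := @minimal_set_cover H K (cyl y n) sgH mK.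
- by apply/open_cylP => x xy; exists n; rewrite (cyl_eq xy).
- by exists y.
have [_ _ iK _] := mK.
apply: (@sub_finite_set _ _ [set` map (fun h => h^-1 y) s]); last exact: finite_seq.
move=> _ [h Hh <-]; have [k ks kh] := sP (h y) (iK _ _ Hh Ky).
apply/mapP; exists k => //; apply: (@homeo_inj _ k); rewrite homeoVK.
apply: contrapT => ne; apply: nz; exists (k (h y)); split => //.
exact: (iK _ _ (sH _ ks) (iK _ _ Hh Ky)).
Qed.

End MinimalSets.

(** * Expansion and contraction on minimal sets *)

Section Expansion.
Local Open Scope group_scope.
Variables (R : realType) (T : rootedTree) (lt : T -> rel T).
Hypotheses (ltT : children_orders lt) (lfT : locally_finite T).
Local Notation X := (boundary R T).
Implicit Types (x y z : X) (K C D E : set X) (g h k : homeo X).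
Local Notation good := (good lt).

Lemma good1 D : cylinder D -> good 1 D.
Proof.
move=> cD; split => //; first by rewrite image_id.
by split => //; exists 0%N, 0%N.
Qed.

Definition locally_good g :=
  forall x, exists n, forall m, n <= m -> good g (cyl x m).

Lemma good_expg g E i : good g E -> g @` E `<=` E -> good (g ^+ i) E.
Proof.
move=> gE sE; elim: i => [|i IH]; first by rewrite expg0; apply: good1; case: gE.
rewrite expgSr; apply: good_comp => //; apply: good_sub IH _ sE => //.
by case: gE.
Qed.

(** The iterated images of [E] are strictly nested cylinders, so the [i]-th has level at least [i].
    They shrink to the ray read off diagonally from the vertices of [(g ^+ i) x] at level [i]. *)
Lemma contraction_fixpoint g E : good g E -> g @` E `<=` E -> g @` E <> E ->
  exists a, [/\ E a, g a = a & forall i, (g ^+ i) @` E `<=` cyl a i].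
Proof.
move=> gE sE nE; have [[x [l0 El]] _ _] := gE.
have Ex : E x by rewrite El.
have DS i : (g ^+ i.+1) @` E = g @` ((g ^+ i) @` E).
  by rewrite expgS homeo_image_comp.
have Dsub i j : i <= j -> (g ^+ j) @` E `<=` (g ^+ i) @` E.
  move=> /subnKC <-; elim: (j - i)%N => [|d IH]; first by rewrite addn0.
  rewrite addnS expgSr homeo_image_comp; apply: subset_trans IH.
  exact: image_subset.
have Dlev i : exists2 l, i <= l & (g ^+ i) @` E = cyl ((g ^+ i) x) l.
  elim: i => [|i [l il Dl]]; first by exists l0; rewrite // expg0 image_id.
  have [_ cD _] := good_expg i.+1 gE sE.
  have [|l' Dl'] := cylinderP cD (x := (g ^+ i.+1) x); first by exists x.
  exists l' => //; rewrite ltnNge; apply/negP => l'i; apply: nE.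
  have gx : cyl ((g ^+ i) x) l ((g ^+ i.+1) x).
    by rewrite -Dl; apply: (Dsub i i.+1) => //; exists x.
  have : (g ^+ i) @` E `<=` (g ^+ i) @` (g @` E).
    rewrite -homeo_image_comp -expgSr Dl' Dl -(cyl_eq gx).
    exact/cyl_sub/(leq_trans l'i).
  move=> sub; apply/seteqP; split => // y Ey.
  have [|_ [z Ez <-] /homeo_inj <-] := sub ((g ^+ i) y); first by exists y.
  by exists z.
have agree i j : i <= j -> ((g ^+ j) x) i = ((g ^+ i) x) i.
  move=> ij; have [l il Dl] := Dlev i.
  have : cyl ((g ^+ i) x) l ((g ^+ j) x) by rewrite -Dl; apply: Dsub ij _ _; exists x.
  exact: cyl_sub.
have ae i : edge (((g ^+ i) x) i) (((g ^+ i.+1) x) i.+1).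
  by rewrite -(agree i i.+1) //; exact: ray_edge.
have a0 : ((g ^+ 0) x) 0%N = tree_root T by rewrite ray_root.
pose a : X := @Ray T (fun i => ((g ^+ i) x) i) a0 ae.
have aD i : (g ^+ i) @` E `<=` cyl a i.
  have [l il ->] := Dlev i; exact: cyl_sub.
have Da i : ((g ^+ i) @` E) a.
  have [l il Dl] := Dlev i; rewrite Dl.
  have : cyl ((g ^+ i) x) l ((g ^+ l) x) by rewrite -Dl; apply: Dsub il _ _; exists x.
  by [].
exists a; split=> //; first by have := Da 0%N; rewrite expg0 image_id.
apply: rayP => i; apply: (aD i); apply: (Dsub i i.+1) => //.
by rewrite DS; exists a.
Qed.

Lemma uniform_good g : locally_good g -> exists L, forall x, good g (cyl x L).
Proof.
move=> gl; apply: uniform_bound => // [x|y m m' mm' gm].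
  have [n nP] := gl x; exists n, n => y xy; rewrite (cyl_eq xy); exact: nP.
by apply: good_sub gm _ _ => //; [exact: cylinder_cyl | exact: cyl_sub].
Qed.

Variable H : set (homeo X).
Hypotheses (sgH : subgroup H) (goodH : forall h, H h -> locally_good h).

(* The maximal translates of D are finitely many and permuted by H; an element
   preserving one of them fixes it pointwise by rigidity. *)
Lemma finite_orbit_of_good D x : cylinder D -> (forall h, H h -> good h D) ->
  (exists s : seq (homeo X), (forall h, h \in s -> H h) /\
     forall h, H h -> exists2 k, k \in s & D (k (h x))) ->
  finite_orbit H x.
Proof.
move=> cD gD [s [sH sP]].
pose top y k := [/\ H k, (k @` D) y &
  forall h, H h -> (h @` D) y -> h @` D `<=` k @` D].
have topM y k h : H h -> top y k -> top (h y) (h * k).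
  move=> Hh [Hk ky kmax]; split; [exact: subgroupM|by rewrite homeo_image_comp; exists y|].
  move=> l Hl ly; rewrite homeo_image_comp.
  have := kmax (h^-1 * l) (subgroupM sgH (subgroupV sgH Hh) Hl).
  rewrite homeo_image_comp => /(_ _) sub z lz; exists (h^-1 z); last exact: homeoVK.
  by apply: sub; [exists (h y) => //; exact: homeoKV|exists z].
have topE y z k l h : H h -> (h @` D) y -> (h @` D) z -> top y k -> top z l ->
    k @` D = l @` D.
  move=> Hh hy hz [Hk ky kmax] [Hl lz lmax]; apply/seteqP; split.
    by apply: lmax => //; exact: kmax hz.
  by apply: kmax => //; exact: lmax hy.
(* Translates of [D] containing [x] are cylinders about [x], hence nested; one of least level is the
   largest. *)
have [k [Hk [w Dw kw] kmax]] : exists k, top x k.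
  have [k0 k0s Dk0] := sP 1 (subgroup1 sgH).
  pose P m := `[< exists2 h, H h & h @` D = cyl x m >].
  have exP : exists m, P m.
    have Hk0 := subgroupV sgH (sH _ k0s); have [_ c0 _] := gD _ Hk0.
    have [|m mE] := cylinderP c0 (x := x).
      by exists (k0 x) => //; exact: homeoKV.
    by exists m; apply/asboolP; exists k0^-1.
  case: (ex_minnP exP) => m /asboolP[k Hk kE] mmin; exists k; split => //.
    by rewrite kE.
  move=> h Hh hx; have [_ ch _] := gD _ Hh; have [m' hE] := cylinderP ch hx.
  rewrite hE kE; apply/cyl_sub/mmin/asboolP; by exists h.
have topx : top x k by split => //; exists w.
(* Both points lie in the translate of [D] by [t^-1], so they share a maximal translate, and
   [h'^-1 * h] preserves the one containing [x]. *)
have fixx h h' t : H h -> H h' -> H t -> D (t (h x)) -> D (t (h' x)) -> h x = h' x.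
  move=> Hh Hh' Ht Dh Dh'; have HVt := subgroupV sgH Ht.
  have e : (h * k) @` D = (h' * k) @` D.
    apply: (topE (h x) (h' x) _ _ t^-1); [by []| | |exact: topM|exact: topM].
    - by exists (t (h x)) => //; exact: homeoKV.
    - by exists (t (h' x)) => //; exact: homeoKV.
  have Hu : H (h'^-1 * h) by apply: subgroupM => //; exact: subgroupV.
  have gu : good (h'^-1 * h) (k @` D).
    have gk := good_inv ltT (gD _ Hk).
    have -> : h'^-1 * h = (h'^-1 * h * k) * k^-1 by rewrite mulgK.
    apply: good_comp => //; rewrite homeo_image_inv.
    by apply: gD; exact: subgroupM.
  have := rigid ltT lfT gu _ (ex_intro2 _ _ w Dw kw).
  rewrite homeo_image_comp -(homeo_image_comp h) e homeo_image_comp homeo_image_inv.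
  by move=> /(_ erefl) {2}<-; rewrite homeoME homeoVK.
have step (t : homeo X) : exists p : X, (exists2 h, H h & D (t (h x))) ->
    exists2 h, H h & D (t (h x)) /\ p = h x.
  have [[h Hh Dh]|n] := pselect (exists2 h, H h & D (t (h x))); last by exists x.
  by exists (h x) => _; exists h.
have [p pP] := choice step.
apply: (@sub_finite_set _ _ [set` map p s]); last exact: finite_seq.
move=> _ [h Hh <-]; have [t ts Dt] := sP h Hh; apply/mapP; exists t => //.
have [|h' Hh' [Dh' ->]] := pP t; first by exists h.
exact: (fixx _ _ t) (sH _ ts) Dt Dh'.
Qed.

Hypothesis fgH : finitely_generated H.

(** Let [L] be a level at which all generators and their inverses are good. If all good images of a
    cylinder meeting [K] fit into cylinders of level [L], goodness propagates along words and orbits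
    are finite. So arbitrarily small cylinders about [x0] have images containing a cylinder of level
    [L], and the inverses shrink the latter. *)
Lemma minimal_set_expansion K : minimal_set H K ->
  (forall x, K x -> ~ finite_orbit H x) ->
  exists y L, K y /\ forall x n, K x ->
    exists h, [/\ H h, good h (cyl y L) & h @` cyl y L `<=` cyl x n].
Proof.
move=> mK infK; have [[x0 Kx0] cK iK dK] := mK.
have [S /finite_seqP[s sE] HS] := fgH.
have SH g : g \in s -> H g by move=> gs; rewrite HS => A [_]; apply; rewrite sE.
have [L LP] : exists L, forall g, g \in s -> forall x,
    good g (cyl x L) /\ good g^-1 (cyl x L).
  elim: s SH {sE} => [|g s IH] SH; first by exists 0%N.
  have [|L LP] := IH; first by move=> h hs; apply: SH; rewrite inE hs orbT.
  have Hg : H g by apply: SH; exact: mem_head.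
  have [L1 L1P] := uniform_good (goodH Hg).
  have [L2 L2P] := uniform_good (goodH (subgroupV sgH Hg)).
  have up h x l m : l <= m -> good h (cyl x l) -> good h (cyl x m).
    by move=> lm hl; apply: good_sub hl _ _ => //; [exact: cylinder_cyl|exact: cyl_sub].
  exists (maxn L (maxn L1 L2)) => h; rewrite inE => /orP[/eqP->|hs] x; split.
  - by apply: up (L1P x); lia.
  - by apply: up (L2P x); lia.
  - by apply: up (LP h hs x).1; lia.
  - by apply: up (LP h hs x).2; lia.
have [[D [x [n DE]] [[y Ky Dy] small]]|big] := pselect (exists2 D, cylinder D &
    (exists2 y, K y & D y) /\
    forall h, H h -> good h D -> exists y, h @` D `<=` cyl y L).
  have cD : cylinder D by rewrite DE; exact: cylinder_cyl.
  exfalso; apply: (infK y Ky); apply: (finite_orbit_of_good cD); last first.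
    have [||t [tH tP]] := minimal_set_cover lfT (E := D) sgH mK.
    - by apply/open_cylP => z; rewrite DE => xz; exists n; rewrite (cyl_eq xz).
    - by exists y.
    by exists t; split => // h Hh; apply: tP; exact: iK.
  (* Including inverses makes [Q] a subgroup, so checking the generators suffices. *)
  pose Q := [set h | forall k, H k -> good k D ->
    [/\ H (h * k), H (h^-1 * k), good (h * k) D & good (h^-1 * k) D]].
  have HQ : H `<=` Q.
    rewrite HS; apply: smallest_sub.
      apply: subgroupP => [k Hk gk|g h gQ hQ k Hk gk|g gQ k Hk gk].
      - by rewrite invg1 mul1g.
      - rewrite invgM -!mulgA; have [H1 H2 g1 g2] := hQ k Hk gk.
        have [H3 H4 g3 g4] := gQ k Hk gk.
        by have [? _ ? _] := gQ _ H1 g1; have [_ ? _ ?] := hQ _ H4 g4.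
      - by rewrite invgK; have [] := gQ k Hk gk.
    move=> g Sg k Hk gk; have gs : g \in s by move: Sg; rewrite sE.
    have [y' kD] := small k Hk gk; have [g1 g2] := LP g gs y'.
    have Hg := SH g gs; have ck : cylinder (k @` D) by case: gk.
    split; [exact: subgroupM|by apply: subgroupM => //; exact: subgroupV| |];
      by apply: good_comp => //; exact: good_sub kD.
  by move=> h Hh; have [_ _] := HQ h Hh 1 (subgroup1 sgH) (good1 cD); rewrite mulg1.
(* Compactness selects one cylinder for all [n]: otherwise some [cyl x0 M] would receive no cylinder
   of level [L] meeting [K] by a good map, and would satisfy the case excluded by [big]. *)
have [y [[z yz Kz] yP]] : exists y, (exists2 z, cyl y L z & K z) /\ forall n,
    exists h, [/\ H h, good h (cyl y L) & h @` cyl y L `<=` cyl x0 n].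
  apply: contrapT => nex.
  have [|y m m' mm' Qm yz h Hh gh hs|M MP] := @uniform_bound T lfT (fun y m =>
    (exists2 z, cyl y L z & K z) -> forall h, H h -> good h (cyl y L) ->
    ~ h @` cyl y L `<=` cyl x0 m).
  - move=> y; exists L; apply: contrapT => nm; apply: nex; exists y.
    have ny m : ~ ((exists2 z, cyl y L z & K z) -> forall h, H h ->
        good h (cyl y L) -> ~ h @` cyl y L `<=` cyl x0 m).
      by move=> h; apply: nm; exists m => y' yy'; rewrite (cyl_eq yy').
    split; first by apply: contrapT => nz; apply: (ny 0%N).
    move=> n; apply: contrapT => nh; apply: (ny n) => _ h Hh gh hs.
    by apply: nh; exists h.
  - exact: (Qm yz h Hh gh (subset_trans hs (cyl_sub mm'))).
  apply: big; exists (cyl x0 M); first exact: cylinder_cyl.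
  split; first by exists x0.
  move=> h Hh gh; exists (h x0); have [_ ch _] := gh.
  have [|n hE] := cylinderP ch (x := h x0); first by exists x0.
  rewrite hE; have [Ln|nL] := leqP L n; first exact: cyl_sub.
  have sub : cyl (h x0) L `<=` h @` cyl x0 M by rewrite hE; exact/cyl_sub/ltnW.
  exfalso; apply: (MP (h x0) _ h^-1).
  - by exists (h x0) => //; exact: iK.
  - exact: subgroupV.
  - by apply: good_sub (good_inv ltT gh) _ sub => //; exact: cylinder_cyl.
  - by rewrite -(homeo_image_inv h (cyl x0 M)); exact: image_subset.
exists z, L; split => // x n Kx; rewrite (cyl_eq yz).
have [k Hk kx] := dK x0 x n Kx0 Kx.
have [m km] := homeo_cyl k x0 n; have [m' gm] := goodH Hk x0.
have [h [Hh gh hs]] := yP (maxn m m').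
have km' := gm _ (leq_maxr m m').
have chy : cylinder (h @` cyl y L) by case: gh.
exists (k * h); split; first exact: subgroupM.
  by apply: good_comp => //; exact: good_sub hs.
rewrite (homeo_image_comp k h) -(cyl_eq kx); apply: subset_trans km.
apply: image_subset; apply: subset_trans hs _; exact/cyl_sub/leq_maxl.
Qed.

(** Since [y] is not isolated in [K], shrinking [cyl y L] towards [y] beyond another point of [K]
    makes its image proper. *)
Lemma minimal_set_contraction K : minimal_set H K ->
  (forall x, K x -> ~ finite_orbit H x) ->
  exists y L, [/\ K y,
    forall x n, K x -> exists2 h, H h & h @` cyl y L `<=` cyl x n &
    exists h, [/\ H h, good h (cyl y L), h @` cyl y L `<=` cyl y L &
      h @` cyl y L <> cyl y L]].
Proof.
move=> mK infK; have [y [L [Ky yP]]] := minimal_set_expansion mK infK.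
exists y, L; split => // [x n Kx|]; first by have [h [Hh _ hs]] := yP x n Kx; exists h.
have [z [Kz yz zy]] := minimal_set_nonisolated lfT L sgH mK Ky (infK y Ky).
have [n /eqP zyn] := ray_neqP zy.
have [h [Hh gh hs]] := yP y (maxn n L) Ky; exists h; split => //.
  by apply: subset_trans hs _; exact/cyl_sub/leq_maxr.
move=> hE; apply: zyn; move: yz; rewrite -hE => /hs.
by apply: cyl_sub; exact: leq_maxl.
Qed.

End Expansion.

(** * Dynamics of a single element *)

Lemma seq_eventually (I : eqType) (s : seq I) (P : I -> nat -> Prop) :
  (forall x, x \in s -> exists N, forall i, N <= i -> P x i) ->
  exists N, forall x i, x \in s -> N <= i -> P x i.
Proof.
elim: s => [|x s IH] sP; first by exists 0%N.
have [|N NP] := IH; first by move=> y ys; apply: sP; rewrite inE ys orbT.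
have [M MP] := sP x (mem_head _ _).
exists (maxn M N) => y i; rewrite inE geq_max => /orP[/eqP->|ys] /andP[Mi Ni].
  exact: MP.
exact: NP.
Qed.

Section SingleElement.
Local Open Scope group_scope.
Variables (R : realType) (T : rootedTree) (lt : T -> rel T).
Hypotheses (ltT : children_orders lt) (lfT : locally_finite T).
Local Notation X := (boundary R T).
Implicit Types (x y z : X) (K C D E : set X) (h : homeo X).

Lemma homeo_expgD (g : homeo X) i j x : (g ^+ (i + j)) x = (g ^+ i) ((g ^+ j) x).
Proof. by rewrite expgnDr. Qed.

Lemma homeo_expg_comm (g : homeo X) i j x :
  (g ^+ i) ((g ^+ j) x) = (g ^+ j) ((g ^+ i) x).
Proof. by rewrite -!homeo_expgD addnC. Qed.

Lemma homeo_expg_fix (g : homeo X) i x : g x = x -> (g ^+ i) x = x.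
Proof. by move=> gx; elim: i => // i IH; rewrite expgS homeoME IH. Qed.

Lemma periodic_of_repeat (g : homeo X) x i j : i <> j ->
  (g ^+ i) x = (g ^+ j) x -> exists2 n, 0 < n & (g ^+ n) x = x.
Proof.
wlog ij : i j / i < j => [wl|_ e].
  move=> ne; have [ij|ji|//] := ltngtP i j; first exact: wl.
  by move=> e; apply: (wl j i) => // ji'; apply: ne.
exists (j - i)%N; first by rewrite subn_gt0.
by apply: (@homeo_inj _ (g ^+ i)); rewrite -homeo_expgD subnKC // ltnW.
Qed.

Variable g : homeo X.
Let G : set (homeo X) := smallest (@subgroup _) [set g].
Hypothesis goodG : forall h, G h -> locally_good lt h.

Let sgG : subgroup G. Proof. exact: smallest_subgroup. Qed.

Let Gg : G g. Proof. by move=> A [_]; apply. Qed.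

Lemma cyclic_fraction h : G h -> exists i j, h = g ^+ i * g ^- j.
Proof.
have Q : subgroup [set h | exists i j, h = g ^+ i * g ^- j].
  apply: subgroupP => [|_ _ [i [j ->]] [i' [j' ->]]|_ [i [j ->]]].
  - by exists 0%N, 0%N; rewrite !expg0 invg1 mulg1.
  - exists (i + i')%N, (j' + j)%N; rewrite !expgnDr invgM !mulgA; congr (_ * _).
    rewrite -!mulgA; congr (_ * _).
    have : commute (g ^+ i') (g ^- j) by apply: commuteV; exact: commuteX2.
    by move=> ->.
  - exists j, i; rewrite invgM invgK; have : commute (g ^+ j) (g ^- i).
      by apply: commuteV; exact: commuteX2.
    by move=> ->.
move=> Gh; have : [set h | exists i j, h = g ^+ i * g ^- j] h; last by [].
by apply: Gh; split => // _ ->; exists 1%N, 0%N; rewrite expg1 expg0 invg1 mulg1.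
Qed.

(* Without a finite orbit, some power of g would contract a ball meeting K, and its
   fixed point would have a finite orbit. *)
Lemma cyclic_minimal_set_periodic K : minimal_set G K ->
  exists a n, [/\ K a, 0 < n & (g ^+ n) a = a].
Proof.
move=> mK; have [_ cK iK _] := mK.
have [[x Kx fx]|infK] := pselect (exists2 x, K x & finite_orbit G x).
  have [s sE] : exists s : seq X, orbit_under G x = [set` s] by exact/finite_seqP.
  have [i [j [ij e]]] : exists i j, i < j /\ (g ^+ i) x = (g ^+ j) x.
    apply: contrapT => nij.
    have inj : injective (fun i => (g ^+ i) x).
      move=> i j e; case: (ltngtP i j) => // ij; exfalso; apply: nij.
        by exists i, j.
      by exists j, i.
    have := @uniq_leq_size _ (mkseq (fun i => (g ^+ i) x) (size s).+1) s.
    rewrite mkseq_uniq // size_mkseq ltnn => h; suff: false by [].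
    apply: h => // _ /mapP[i _ ->]; suff : [set` s] ((g ^+ i) x) by [].
    by rewrite -sE; exists (g ^+ i) => //; exact: (subgroupX sgG).
  have [|n n0 gn] := periodic_of_repeat _ e; first by move=> ij'; rewrite ij' ltnn in ij.
  by exists x, n.
have [||y [L [Ky _ [h [Gh gh hs hE]]]]] := minimal_set_contraction ltT lfT sgG goodG _ mK.
- by exists [set g].
- by move=> x Kx fx; apply: infK; exists x.
have [a [_ ha aP]] := contraction_fixpoint gh hs hE.
have Ka : K a.
  move/closed_cylP: (cK); apply => n; exists ((h ^+ n) y).
    by apply: iK => //; exact: (subgroupX sgG).
  by apply: aP; exists y.
(* As [h] fixes [a], the powers [i] and [j] of [g] agree at [(g ^- j) a]; they are distinct because
   [h] is not the identity. *)
have [i [j hij]] := cyclic_fraction Gh.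
have Kb : K ((g ^- j) a) by apply: iK => //; apply: (subgroupV sgG); exact: (subgroupX sgG).
have [||n n0 nb] := @periodic_of_repeat g ((g ^- j) a) i j.
- by move=> ij; apply: hE; rewrite hij ij mulgV image_id.
- by rewrite homeoVK -[LHS]homeoME -hij.
by exists ((g ^- j) a), n.
Qed.

Definition neutral x n k := forall y, cyl x n y -> (g ^+ k) y = y.

Definition attracted x n k a := forall m, exists i0, forall i y,
  i0 <= i -> cyl x n y -> cyl a m ((g ^+ (k * i)) y).

(** Stated through preimages: those of [cyl x n] under powers of [g ^+ k] shrink to [x]. *)
Definition repelling x n k := forall m, exists i0, forall i y,
  i0 <= i -> cyl x n ((g ^+ (k * i)) y) -> cyl x m y.

Lemma neutral_mul x n k c : neutral x n k -> neutral x n (k * c).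
Proof.
by move=> nk y /nk gy; rewrite expgnA; exact: homeo_expg_fix.
Qed.

Lemma attracted_mul x n k a c : 0 < c -> attracted x n k a ->
  attracted x n (k * c) a.
Proof.
move=> c0 ak m; have [i0 iP] := ak m; exists i0 => i y i0i.
rewrite -mulnA; apply: iP; rewrite (leq_trans i0i) //; exact: leq_pmull.
Qed.

Lemma repelling_mul x n k c : 0 < c -> repelling x n k -> repelling x n (k * c).
Proof.
move=> c0 rk m; have [i0 iP] := rk m; exists i0 => i y i0i.
rewrite -mulnA; apply: iP; rewrite (leq_trans i0i) //; exact: leq_pmull.
Qed.

Let omega x : set X := [set y | forall n N, exists2 i, N <= i & cyl y n ((g ^+ i) x)].

Lemma omega_invariant x : invariant_under G (omega x).
Proof.
have Q : subgroup [set h : homeo X | forall y, omega x y <-> omega x (h y)].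
  apply: subgroupP => [//|h k hQ kQ y|h hQ y].
    by rewrite homeoME (kQ y) (hQ (k y)).
  by rewrite (hQ (h^-1 y)) homeoVK.
suff GQ : G `<=` [set h : homeo X | forall y, omega x y <-> omega x (h y)].
  by move=> h y /GQ /= ->.
apply: smallest_sub => // _ -> y; split => yP n N.
  have [m gm] := homeo_cyl g y n; have [i Ni yi] := yP m N.
  exists i.+1; first exact: ltnW.
  by apply: gm; rewrite expgS homeoME; exists ((g ^+ i) x).
have [m gm] := homeo_cyl g^-1 (g y) n; have [[//|i] Ni yi] := yP m N.+1.
exists i => //; rewrite homeoKV in gm; apply: gm.
by exists ((g ^+ i.+1) x) => //; rewrite expgS homeoME homeoKV.
Qed.

Lemma omega_periodic x : exists a n, [/\ omega x a, 0 < n & (g ^+ n) a = a].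
Proof.
have [|||K mK Kw] := @minimal_set_exists R T lfT G (omega x) sgG.
- apply: contrapT => n0.
  have step y : exists nN : nat * nat, forall i, nN.2 <= i -> ~ cyl y nN.1 ((g ^+ i) x).
    have /existsNP[n /existsNP[N yP]] : ~ omega x y by move=> wy; apply: n0; exists y.
    by exists (n, N) => i Ni yi; apply: yP; exists i.
  have [f fP] := choice step.
  have [s sP] := cylinder_cover lfT (fun y => (f y).1).
  have [y ys yx] := sP ((g ^+ (\max_(y <- s) (f y).2)) x).
  apply: (fP y _ _ yx); exact: leq_bigmax_seq.
- apply/closed_cylP => y yP n N; have [z wz yz] := yP n.
  by have [i Ni zi] := wz n N; exists i => //; rewrite -(cyl_eq yz).
- exact: omega_invariant.
have [a [n [Ka n0 na]]] := cyclic_minimal_set_periodic mK.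
by exists a, n; split => //; exact: Kw.
Qed.

(** A power [f] of [g] fixes a point [a] of the omega-limit set and maps a cylinder about [a] onto
    another one, so the two are nested. Equality gives the neutral case by rigidity; otherwise [f]
    or its inverse contracts. The conclusion is pulled back to [x] along its orbit. *)
Lemma trichotomy x : exists k n, 0 < k /\
  [\/ neutral x n k, exists a, attracted x n k a | repelling x n k].
Proof.
have [a [k [wa k0 fa]]] := omega_periodic x; exists k.
have Gf : G (g ^+ k) by exact: (subgroupX sgG).
set f := g ^+ k in fa Gf *.
have fE i y : (f ^+ i) y = (g ^+ (k * i)) y by rewrite expgnA.
have [n /(_ n (leqnn n)) fB] := goodG Gf a.
have cB : cylinder (f @` cyl a n) by case: fB.
have [|n' fBE] := cylinderP cB (x := a); first by exists a.
have [i0 _ ai0] := wa n 0%N.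
have [m gm] := homeo_cyl (g ^+ i0) x n; rewrite (cyl_eq ai0) in gm.
have gB y : cyl x m y -> cyl a n ((g ^+ i0) y) by move=> xy; apply: gm; exists y.
have [nn'|n'n] := leqP n n'.
  have sB : f @` cyl a n `<=` cyl a n by rewrite fBE; exact: cyl_sub.
  exists m; split => //.
  have [eB|nB] := pselect (f @` cyl a n = cyl a n).
    apply: Or31 => y /gB ay; apply: (@homeo_inj _ (g ^+ i0)).
    by rewrite homeo_expg_comm; exact: (rigid ltT lfT fB).
  apply: Or32; have [b [_ _ bP]] := contraction_fixpoint fB sB nB.
  exists ((g ^- i0) b) => p; have [q qP] := homeo_cyl (g ^- i0) b p.
  exists q => i y qi /gB ay; apply: qP; exists ((f ^+ i) ((g ^+ i0) y)).
    by apply: (cyl_sub qi); apply: bP; exists ((g ^+ i0) y).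
  by rewrite fE homeo_expg_comm homeoKV.
have fC := good_inv ltT fB.
have sC : f^-1%g @` (f @` cyl a n) `<=` f @` cyl a n.
  by rewrite (homeo_image_inv f) fBE; apply: cyl_sub; exact: ltnW.
(* Cylinders of different levels coincide when the tree does not branch in between, so the neutral
   case can recur. *)
have [eC|nC] := pselect (f^-1%g @` (f @` cyl a n) = f @` cyl a n).
  rewrite (homeo_image_inv f) in eC; exists m; split => //.
  apply: Or31 => y /gB ay; apply: (@homeo_inj _ (g ^+ i0)).
  by rewrite homeo_expg_comm; exact: (rigid ltT lfT fB).
have [b [_ _ bP]] := contraction_fixpoint fC sC nC.
have VfE i y : (f^-1 ^+ i) ((g ^+ (k * i)) y) = y by rewrite -fE expVgn homeoKV.
have aP i : (f^-1 ^+ i) @` (f @` cyl a n) `<=` cyl a i.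
  have ab : b = a :> X.
    apply: rayP => j; symmetry; apply: (bP j); exists a; first by exists a.
    by apply: homeo_expg_fix; rewrite -{1}fa homeoKV.
  by move=> y /(bP i); rewrite ab.
(* A visit near [a] at time [i], pulled back by [i %/ k] steps of [f^-1], puts [(g ^+ (i %% k)) x]
   in [cyl a (i %/ k)]. Late visits thus force one of the first [k] iterates to equal [a]. *)
have [r rk gr] : exists2 r, r < k & (g ^+ r) x = a.
  apply: contrapT => nr.
  have [N NP] : exists N, forall r i, r \in iota 0 k -> N <= i -> ~ cyl a i ((g ^+ r) x).
    apply: seq_eventually => r; rewrite mem_iota add0n => /andP[_ rk].
    have ne : (g ^+ r) x <> a by move=> e; apply: nr; exists r.
    have [N /eqP neN] := ray_neqP ne; exists N => i Ni /(cyl_sub Ni); exact: neN.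
  have [i Ni ai] := wa n' (N * k)%N.
  apply: (NP (i %% k)%N (i %/ k)%N).
  - by rewrite mem_iota /= ltn_mod.
  - by rewrite leq_divRL.
  - apply: aP; rewrite fBE; exists ((g ^+ i) x) => //.
    have -> : (g ^+ i) x = (g ^+ (k * (i %/ k))) ((g ^+ (i %% k)) x).
      by rewrite -homeo_expgD mulnC -divn_eq.
    exact: VfE.
have [p gp] := homeo_cyl (g ^+ r) x n'; rewrite gr in gp.
exists p; split => //; apply: Or33 => q.
have [u uP] := homeo_cyl (g ^- r) a q; exists u => i y ui xy.
have : cyl a i ((g ^+ r) y).
  apply: aP; rewrite fBE; exists ((g ^+ (k * i)) ((g ^+ r) y)); last exact: VfE.
  by apply: gp; exists ((g ^+ (k * i)) y) => //; exact: homeo_expg_comm.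
move=> /(cyl_sub ui) ay; have xE : (g ^- r) a = x by rewrite -gr homeoKV.
rewrite xE in uP; apply: uP; by exists ((g ^+ r) y) => //; exact: homeoKV.
Qed.

(** Finitely many cylinders from [trichotomy] cover the boundary; [k] is the product of their
    periods, so one power of [g] serves them all. *)
Lemma power_dynamics : exists k (Z : set X) (rep att : seq X), [/\ 0 < k, open Z,
  forall z, Z z -> (g ^+ k) z = z &
  forall U V : set X, open U -> open V -> [set` rep] `<=` U -> [set` att] `<=` V ->
    exists i, forall y, ~ Z y -> ~ U y -> V ((g ^+ (k * i)) y)].
Proof.
have step x : exists d : nat * nat * X, 0 < d.1.1 /\
  [\/ neutral x d.1.2 d.1.1, attracted x d.1.2 d.1.1 d.2 | repelling x d.1.2 d.1.1].
  have [k [n [k0 [nk|[a ak]|rk]]]] := trichotomy x.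
  - by exists (k, n, x); split => //; exact: Or31.
  - by exists (k, n, a); split => //; exact: Or32.
  - by exists (k, n, x); split => //; exact: Or33.
have [f fP] := choice step.
pose per x := (f x).1.1; pose lev x := (f x).1.2; pose lim x := (f x).2.
have [s sP] := cylinder_cover lfT lev.
pose k := (\prod_(x <- s) per x)%N.
have k0 : 0 < k.
  by rewrite /k; elim: s {sP k} => [|x s IH]; rewrite ?big_nil // big_cons muln_gt0 IH (fP x).1.
have kE x : x \in s -> exists2 c, 0 < c & k = (per x * c)%N.
  move=> xs; have /dvdnP[c kc] : per x %| k by rewrite /k (big_rem x xs) dvdn_mulr.
  by exists c; rewrite 1?mulnC // lt0n; apply/negP => /eqP c0; rewrite kc c0 in k0.
have sT x : x \in s -> [\/ neutral x (lev x) k, attracted x (lev x) k (lim x) | repelling x (lev x) k].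
  move=> /kE[c c0 ->]; have [_ [nk|ak|rk]] := fP x.
  - by apply: Or31; exact: neutral_mul.
  - by apply: Or32; exact: attracted_mul.
  - by apply: Or33; exact: repelling_mul.
pose Z : set X := [set y | exists x, [/\ x \in s, neutral x (lev x) k & cyl x (lev x) y]].
pose rep := [seq x <- s | `[< repelling x (lev x) k >]].
pose att := [seq lim x | x <- s & `[< attracted x (lev x) k (lim x) >]].
exists k, Z, rep, att; split => //.
- apply/open_cylP => y [x [xs nx xy]]; exists (lev x) => z yz.
  by exists x; split => //; rewrite -(cyl_eq xy).
- by move=> z [x [_ nx /nx]].
move=> U V /open_cylP oU /open_cylP oV rU aV.
have [N NP] : exists N, forall x i, x \in s -> N <= i ->
    attracted x (lev x) k (lim x) -> forall y, cyl x (lev x) y -> V ((g ^+ (k * i)) y).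
  apply: seq_eventually => x xs.
  have [ax|nax] := pselect (attracted x (lev x) k (lim x)); last by exists 0%N.
  have [m mV] : exists m, cyl (lim x) m `<=` V.
    apply: oV; apply: aV; apply/mapP; exists x => //.
    by rewrite mem_filter xs andbT; exact/asboolP.
  have [i0 i0P] := ax m; exists i0 => i ii _ y xy; apply: mV; exact: i0P.
have [M MP] : exists M, forall x i, x \in s -> M <= i ->
    repelling x (lev x) k -> forall y, cyl x (lev x) ((g ^+ (k * i)) y) -> U y.
  apply: seq_eventually => x xs.
  have [rx|nrx] := pselect (repelling x (lev x) k); last by exists 0%N.
  have [m mU] : exists m, cyl x m `<=` U.
    by apply: oU; apply: rU; rewrite /= mem_filter xs andbT; exact/asboolP.
  have [i0 i0P] := rx m; exists i0 => i ii _ y xy; apply: mU; exact: i0P xy.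
(* After [M] rounds a point off [U] is outside the repelling cylinders, and in a neutral one only if
   it was in [Z] already; [N] further rounds carry it from an attracted cylinder into [V]. *)
exists (N + M)%N => y nZ nU; rewrite mulnDr homeo_expgD.
have [x xs xy] := sP ((g ^+ (k * M)) y).
have [nx|ax|rx] := sT x xs.
- exfalso; apply: nZ; suff -> : y = (g ^+ (k * M)) y by exists x.
  apply: (@homeo_inj _ (g ^+ (k * M))).
  by have := homeo_expg_fix M (nx _ xy); rewrite -expgnA.
- exact: NP ax _ xy.
- by exfalso; apply: nU; exact: MP rx _ xy.
Qed.

End SingleElement.

(** * Contraction and ping-pong *)

Section PingPong.
Local Open Scope group_scope.
Variables (R : realType) (T : rootedTree) (lt : T -> rel T).
Hypotheses (ltT : children_orders lt) (lfT : locally_finite T).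
Local Notation X := (boundary R T).
Implicit Types (x y z : X) (K C D E : set X) (g h k : homeo X) (F W : seq X).

Variable H : set (homeo X).
Hypotheses (sgH : subgroup H) (infH : forall x, ~ finite_orbit H x).

(* Induction on F, as in B. H. Neumann's lemma on coverings by cosets: some t0 maps f
   outside W, so the elements h with h f \in W are controlled by F alone, at the
   price of enlarging W. *)
Lemma neumann_separation F W :
  exists2 h, H h & forall x, x \in F -> h x \notin W.
Proof.
elim: F W => [|f F IH] W; first by exists 1 => //; exact: subgroup1.
apply: contrapT => nh.
have hit h : H h -> exists2 x, x \in f :: F & h x \in W.
  move=> Hh; apply: contrapT => nx; apply: nh; exists h => // x xF.
  by apply/negP => hx; apply: nx; exists x.
have [t0 Ht0 t0f] : exists2 t, H t & t f \notin W.
  apply: contrapT => nt; apply: (infH (x := f)).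
  apply: (@sub_finite_set _ _ [set` W]); last exact: finite_seq.
  by move=> _ [h Hh <-]; apply/negP => /negP hf; apply: nt; exists h.
have step (w : X) : exists t : homeo X, (exists2 u, H u & u f = w) -> H t /\ t f = w.
  have [[u Hu uw]|n] := pselect (exists2 u, H u & u f = w); last by exists 1.
  by exists u.
have [t tP] := choice step.
(* If [h f] is in [W], put [u = t (h f)]: then [t0 * (u^-1 * h)] sends [f] to [t0 f], off [W], so it
   sends some [y] of [F] into [W]. This puts [h y] in the added list. *)
have [h Hh hF] := IH (W ++ [seq t w (t0^-1 w') | w <- W, w' <- W]).
have [x] := hit h Hh; rewrite inE => /orP[/eqP->|xF] hx; last first.
  by have := hF x xF; rewrite mem_cat hx.
have [|Ht tf] := tP (h f); first by exists h.
set u := t (h f) in Ht tf.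
have [|y] := hit (t0 * (u^-1 * h)).
  by do 2?apply: subgroupM => //; exact: subgroupV.
rewrite !homeoME inE => /orP[/eqP->|yF] yW.
  by move: yW; rewrite -tf homeoKV (negPf t0f).
have := hF y yF; rewrite mem_cat => /negP; apply; apply/orP; right.
have -> : h y = u (t0^-1 (t0 (u^-1 (h y)))) by rewrite homeoKV homeoVK.
exact: (allpairs_f (fun w w' => t w (t0^-1 w'))).
Qed.

(** First push [F] off all [h^-1 W] for the finitely many [h] of [minimal_set_cover]; whichever [h]
    then returns [y] to [E] keeps [F] off [W]. *)
Lemma minimal_set_separation K E y F W : minimal_set H K -> open E -> K y -> E y ->
  exists h, [/\ H h, E (h y) & forall x, x \in F -> h x \notin W].
Proof.
move=> mK oE Ky Ey; have [|s [sH sP]] := minimal_set_cover lfT sgH mK oE.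
  by exists y.
have [t Ht tF] := neumann_separation F [seq h^-1 w | h : homeo X <- s, w <- W].
have [_ _ iK _] := mK; have [h hs Eh] := sP (t y) (iK t y Ht Ky).
exists (h * t); split => //; first exact: subgroupM (sH h hs) Ht.
move=> x xF; apply/negP => hx; have /negP := tF x xF; apply.
rewrite -[t x](homeoKV h); exact: (allpairs_f (fun h w => (h : homeo X)^-1 w)).
Qed.

(* The translates h^-1 W, h \in ts, are pairwise disjoint, so a set of N points
   misses one of them. *)
Lemma minimal_set_separation_uniform K E y W N : minimal_set H K -> open E ->
  K y -> E y -> exists ts : seq (homeo X),
    (forall h, h \in ts -> H h /\ E (h y)) /\
    forall F, size F <= N -> exists2 h, h \in ts & forall x, x \in F -> h x \notin W.
Proof.
move=> mK oE Ky Ey; elim: N => [|N [ts [tsH tsP]]].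
  have [h [Hh Eh _]] := minimal_set_separation [::] [::] mK oE Ky Ey.
  exists [:: h]; split => [k|F]; first by rewrite inE => /eqP ->.
  by rewrite leqn0 size_eq0 => /eqP ->; exists h => //; exact: mem_head.
have [h [Hh Eh hP]] := minimal_set_separation
  [seq t^-1 w | t : homeo X <- ts, w <- W] W mK oE Ky Ey.
exists (h :: ts); split => [k|F sF].
  by rewrite inE => /orP[/eqP->//|]; exact: tsH.
have [[x xF hx]|nx] := pselect (exists2 x, x \in F & h x \in W); last first.
  exists h; first exact: mem_head.
  by move=> x xF; apply/negP => hx; apply: nx; exists x.
have [|t tts tP] := tsP (rem x F); first by rewrite size_rem // -subn1 leq_subLR add1n.
exists t; first by rewrite inE tts orbT.
move=> y' y'F; have [->|yx] := eqVneq y' x; last first.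
  by apply: tP; move: y'F; rewrite (perm_mem (perm_to_rem xF)) inE (negPf yx).
apply/negP => tx; have := hP x; rewrite hx => /(_ _)/negP; apply => //.
by rewrite -[x](homeoKV t); exact: (allpairs_f (fun h w => (h : homeo X)^-1 w)).
Qed.

(* Z is the neutral set, and rep and att are the repelling and attracting points. *)
Definition contracting Z (rep att : seq X) := forall U V : set X, open U -> open V ->
  [set` rep] `<=` U -> [set` att] `<=` V ->
  exists p, [/\ H p, forall z, Z z -> p z = z & forall y, ~ Z y -> ~ U y -> V (p y)].

Lemma open_homeo_preimage g (U : set X) : open U -> open (g @^-1` U).
Proof. by apply: open_comp => x _; exact: homeo_continuous. Qed.

Lemma open_diff_seq (U : set X) F : open U -> open (U `\` [set` F]).
Proof.
move=> /open_cylP oU; apply/open_cylP => x [Ux xF]; have [n nU] := oU x Ux.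
have [N NP] : exists N, forall y i, y \in F -> N <= i -> ~ cyl x i y.
  apply: seq_eventually => y yF.
  have [m /eqP yxm] : exists m, y m != x m.
    by apply: ray_neqP => yx; apply: xF; rewrite -yx.
  by exists m => i mi /(cyl_sub mi).
exists (maxn n N) => y xy; split; first exact/nU/(cyl_sub (leq_maxl n N)).
by move=> yF; exact: NP yF (leq_maxr n N) xy.
Qed.

(** With no neutral set to be fixed, source and target can be moved independently, unlike in
    [contracting_conj]. *)
Lemma contracting_translate rep att g h : H g -> H h ->
  contracting set0 rep att -> contracting set0 (map h rep) (map g att).
Proof.
move=> Hg Hh c0 U V oU oV rU aV.
have [||||p [Hp _ pV]] := c0 (h @^-1` U) (g @^-1` V).
- exact: open_homeo_preimage.
- exact: open_homeo_preimage.
- by move=> x xr; apply: rU; exact: map_f.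
- by move=> x xa; apply: aV; exact: map_f.
exists (g * (p * h^-1)); split => // [|y _ nU].
  by do 2?apply: subgroupM => //; exact: subgroupV.
by apply: pV; rewrite //= homeoVK.
Qed.

Lemma contracting_conj Z rep att c : H c -> contracting Z rep att ->
  contracting (c @^-1` Z) (map c^-1%g rep) (map c^-1%g att).
Proof.
move=> Hc cZ U V oU oV rU aV.
have [||||p [Hp pZ pV]] := cZ (c^-1%g @^-1` U) (c^-1%g @^-1` V).
- exact: open_homeo_preimage.
- exact: open_homeo_preimage.
- by move=> x xr; apply: rU; exact: map_f.
- by move=> x xa; apply: aV; exact: map_f.
exists (c^-1 * (p * c)); split => [|z Zz|y nZ nU].
- by do 2?apply: subgroupM => //; exact: subgroupV.
- by rewrite !homeoME pZ // homeoKV.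
- by apply: pV => // Uy; apply: nU; rewrite -(homeoKV c y).
Qed.

(* First apply an element for (Z', rep', att'), then one for (Z, rep, att): since
   both fix their neutral sets pointwise, only Z `&` Z' stays uncontrolled. *)
Lemma contracting_comp Z rep att Z' rep' att' :
  contracting Z rep att -> contracting Z' rep' att' ->
  (forall x, x \in att' -> x \notin rep) ->
  contracting (Z `&` Z') (rep ++ rep') (att ++ att').
Proof.
move=> cZ cZ' ar U V oU oV rU aV.
(* Removing [att'] from [U] makes [p] send [att'] into [V], so the preimage of [V] is a valid target
   for the first map. *)
have [||||p [Hp pZ pV]] := cZ (U `\` [set` att']) V.
- exact: open_diff_seq.
- by [].
- move=> x xr; split; first by apply: rU; rewrite /= mem_cat xr.
  by move=> /ar; rewrite xr.
- by move=> x xa; apply: aV; rewrite /= mem_cat xa.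
have [||||p' [Hp' pZ' pV']] := cZ' U (p @^-1` V).
- by [].
- exact: open_homeo_preimage.
- by move=> x xr; apply: rU; rewrite /= mem_cat xr orbT.
- move=> x xa; rewrite /=; have [Zx|nZx] := pselect (Z x).
    by rewrite pZ //; apply: aV; rewrite /= mem_cat xa orbT.
  by apply: pV => // -[].
exists (p * p'); split => [|z [Zz Z'z]|y nZ nU]; first exact: subgroupM.
  by rewrite homeoME pZ' // pZ.
have [Z'y|nZ'y] := pselect (Z' y); last exact: pV'.
rewrite homeoME pZ' //; apply: pV; last by case.
by move=> Zy; exact: nZ.
Qed.

Hypotheses (goodH : forall h, H h -> locally_good lt h) (fgH : finitely_generated H).

(** The level [n] is fixed before [F], so that a finite cover can be chosen before the attracting
    points to be avoided are known. *)
Lemma local_contraction x : exists n Z rep att, contracting Z rep att /\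
  forall F, exists c, [/\ H c, forall y, cyl x n y -> ~ Z (c y) &
    forall f, f \in F -> c f \notin rep].
Proof.
have [|||K mK KO] := @minimal_set_exists R T lfT H
    [set z | forall n, exists2 h, H h & cyl z n (h x)] sgH.
- by exists x => n; exists 1 => //; exact: subgroup1.
- apply/closed_cylP => z zP n; have [w wP wz] := zP n; have [h Hh hw] := wP n.
  by exists h => //; rewrite -(cyl_eq wz).
- move=> h z Hh zP n; have [m hm] := homeo_cyl h z n; have [k Hk kz] := zP m.
  by exists (h * k); [exact: subgroupM|apply: hm; exists (k x)].
have [y [L [Ky yP [g [Hg gg sg nE]]]]] :=
  minimal_set_contraction ltT lfT sgH goodH fgH mK (fun x _ => infH (x := x)).
set E : set X := cyl y L in yP gg sg nE.
have oE : open E by apply/open_cylP => z yz; exists L; rewrite (cyl_eq yz).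
have goodG h : smallest (@subgroup _) [set g] h -> locally_good lt h.
  by move=> Gh; apply: goodH; apply: Gh; split => // _ ->.
have [k [Z [rep [att [k0 oZ fixZ dyn]]]]] := power_dynamics ltT lfT goodG.
(* A neutral point of [E] must be the limit [a]. As [Z] is open, iterates of all of [E] would enter
   [Z] and hence equal [a], making [E] a single point. *)
have ZE z : E z -> ~ Z z.
  have [a [Ea ga aP]] := contraction_fixpoint gg sg nE.
  have Za w : E w -> Z w -> w = a.
    move=> Ew Zw; apply: rayP => i; apply: (cyl_sub (leq_pmull i k0)).
    apply: aP; exists w => //; rewrite expgnA; exact: homeo_expg_fix (fixZ w Zw).
  have gE w i : E w -> E ((g ^+ i) w).
    by move=> Ew; elim: i => // i IH; rewrite expgS; apply: sg; exists ((g ^+ i) w).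
  move=> Ez Zz; have aZ : Z a by rewrite -(Za z).
  have /open_cylP/(_ a aZ)[m mZ] := oZ.
  have onept w : E w -> w = a.
    move=> Ew; apply: (@homeo_inj _ (g ^+ m)); rewrite (homeo_expg_fix m ga).
    by apply: Za; [exact: gE|apply: mZ; apply: aP; exists w].
  apply: nE; apply/seteqP; split => // w /onept ->; by exists a.
have [h1 Hh1 h1x] := KO y Ky L.
have [n h1n] := homeo_cyl h1 x L; rewrite (cyl_eq h1x) in h1n.
exists n, Z, rep, att; split.
  move=> U V oU oV rU aV; have [i iP] := dyn U V oU oV rU aV.
  exists (g ^+ (k * i)); split => //; first exact: subgroupX.
  by move=> z Zz; rewrite expgnA; exact: homeo_expg_fix (fixZ z Zz).
move=> F.
(* The list [ts] depends only on the size of [F]. This breaks a circle: [h2] needs the level [M]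
   obtained from [ts], while the choice of [t] in [ts] depends on [h2]. *)
have [ts [tsH tsP]] :=
  minimal_set_separation_uniform rep (size F) mK oE Ky (cyl_self y L).
have [M MP] : exists M, forall (t : homeo X) i, t \in ts -> M <= i ->
    t @` cyl y i `<=` E.
  apply: seq_eventually => t /tsH[_ Et]; have [m tm] := homeo_cyl t y L.
  exists m => i mi; rewrite (cyl_eq Et) in tm; apply: subset_trans tm.
  by apply: image_subset; exact: cyl_sub.
have [h2 Hh2 h2E] := yP y M Ky.
have [|t tts tF] := tsP (map (h2 * h1) F); first by rewrite size_map.
exists (t * (h2 * h1)); split.
- by do 2?apply: subgroupM => //; exact: (tsH t tts).1.
- move=> w xw; apply: ZE; apply: (MP t M tts (leqnn M)).
  exists (h2 (h1 w)) => //; apply: h2E; exists (h1 w) => //; apply: h1n.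
  by exists w.
- by move=> f fF; apply: tF; exact: map_f.
Qed.

(** Starting from the identity, neutral everywhere, each composition clears one cylinder of a finite
    cover from the neutral set. The conjugator [c] keeps the earlier attracting points off the new
    repelling ones. *)
Lemma global_contraction : exists rep att, contracting set0 rep att.
Proof.
have [n nP] := choice local_contraction.
have [s sP] := cylinder_cover lfT n.
suff [Z [rep [att [cZ Zs]]]] : exists Z rep att, contracting Z rep att /\
    forall x y, x \in s -> cyl x (n x) y -> ~ Z y.
  exists rep, att; suff <- : Z = set0 by [].
  by apply/seteqP; split => // y Zy; have [x xs /Zs] := sP y; exact.
elim: s {sP} => [|x s [Z' [rep' [att' [cZ' Z's]]]]].
  exists setT, [::], [::]; split => // U V _ _ _ _.
  by exists 1; split => [|//|y nT _]; [exact: (subgroup1 sgH)|exfalso; exact: nT].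
have [Z [rep [att [cZ cP]]]] := nP x.
have [c [Hc cx cA]] := cP att'.
exists (c @^-1` Z `&` Z'), (map c^-1%g rep ++ rep'), (map c^-1%g att ++ att').
split.
  apply: contracting_comp => //; first exact: contracting_conj.
  move=> a /cA ca; apply/negP => /mapP[r rr ar]; move: ca.
  by rewrite ar homeoVK rr.
move=> z y; rewrite inE => /orP[/eqP->|zs] zy [Zy Z'y]; first exact: cx zy Zy.
exact: Z's zs zy Z'y.
Qed.

Definition saturation n F : set X := [set y | exists2 x, x \in F & cyl x n y].

Lemma open_saturation n F : open (saturation n F).
Proof.
apply/open_cylP => y [x xF xy]; exists n => z yz; exists x => //.
by rewrite -(cyl_eq xy).
Qed.

Lemma disjoint_saturations F : exists n, forall F1 F2,
  {subset F1 <= F} -> {subset F2 <= F} -> (forall x, x \in F1 -> x \notin F2) ->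
  [disjoint saturation n F1 & saturation n F2].
Proof.
have [n nP] : exists n, forall x i, x \in F -> n <= i ->
    forall y, y \in F -> x i = y i -> x = y.
  apply: seq_eventually => x _.
  have [n nP] : exists n, forall y i, y \in F -> n <= i -> x i = y i -> x = y.
    apply: seq_eventually => y _; have [->|xy] := eqVneq x y; first by exists 0%N.
    have [m /eqP xym] := ray_neqP (elimN eqP xy).
    by exists m => i mi /(ray_vertex_agree mi).
  by exists n => i ni y yF; exact: nP.
exists n => F1 F2 s1 s2 d; apply/disj_setPS => z [[x xF1 xz] [y yF2 yz]].
have := d x xF1; suff -> : x = y by rewrite yF2.
by apply: (nP x n (s1 _ xF1) (leqnn n) y (s2 _ yF2)); rewrite -xz -yz.
Qed.

Lemma ping_pong : has_ping_pong_pair H.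
Proof.
have [rep [att c0]] := global_contraction.
(* The lists [rep], [map a1 att], [map r2 rep] and [map a2 att] are made disjoint one after another;
   their saturations become the ping-pong sets. *)
have [a1 Ha1 a1P] := neumann_separation att rep.
have [r2 Hr2 r2P] := neumann_separation rep (rep ++ map a1 att).
have [a2 Ha2 a2P] := neumann_separation att (rep ++ map a1 att ++ map r2 rep).
have [n dis] := disjoint_saturations
  (rep ++ map a1 att ++ map r2 rep ++ map a2 att).
have sub1 : contracting set0 rep (map a1 att).
  have := contracting_translate Ha1 (subgroup1 sgH) c0.
  by rewrite (_ : map _ rep = rep) // -[RHS]map_id.
have sub2 := contracting_translate Ha2 Hr2 c0.
have incl F : [set` F] `<=` saturation n F by move=> x xF; exists x.
have [g [Hg _ gV]] := sub1 _ _ (@open_saturation n _) (@open_saturation n _)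
  (incl _) (incl _).
have [h [Hh _ hV]] := sub2 _ _ (@open_saturation n _) (@open_saturation n _)
  (incl _) (incl _).
exists g, h; split => //; exists (saturation n rep), (saturation n (map r2 rep)),
  (saturation n (map a1 att)), (saturation n (map a2 att)).
have i1 : {subset rep <= rep ++ map a1 att ++ map r2 rep ++ map a2 att}.
  by move=> x; rewrite !mem_cat => ->.
have i2 : {subset map a1 att <= rep ++ map a1 att ++ map r2 rep ++ map a2 att}.
  by move=> x; rewrite !mem_cat => ->; rewrite orbT.
have i3 : {subset map r2 rep <= rep ++ map a1 att ++ map r2 rep ++ map a2 att}.
  by move=> x; rewrite !mem_cat => ->; rewrite !orbT.
have i4 : {subset map a2 att <= rep ++ map a1 att ++ map r2 rep ++ map a2 att}.
  by move=> x; rewrite !mem_cat => ->; rewrite !orbT.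
split.
- by split; exact: open_saturation.
- split; rewrite disj_set_sym; apply: dis => // _ /mapP[x xF ->].
  + by have := r2P x xF; rewrite mem_cat negb_or => /andP[].
  + exact: a1P.
  + by have := a2P x xF; rewrite !mem_cat !negb_or => /andP[].
- split; [apply: dis | rewrite disj_set_sym; apply: dis |
    rewrite disj_set_sym; apply: dis] => // _ /mapP[x xF ->].
  + by have := r2P x xF; rewrite mem_cat negb_or => /andP[].
  + by have := a2P x xF; rewrite !mem_cat !negb_or => /and3P[].
  + by have := a2P x xF; rewrite !mem_cat !negb_or => /and3P[].
- by move=> _ [y /= ny <-]; exact: gV.
- by move=> _ [y /= ny <-]; exact: hV.
Qed.

End PingPong.

Theorem theoremB (R : realType) (T : rootedTree) (lt : T -> rel T)
    (H : set (homeo (boundary R T))) :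
  locally_finite T -> no_leaves T -> children_orders lt ->
  subgroup H -> H `<=` higman_thompson lt -> finitely_generated H ->
  has_finite_orbit H \/ has_ping_pong_pair H.
Proof.
move=> lfT _ ltT sgH HV fgH.
have [fo|nfo] := pselect (has_finite_orbit H); [by left|right].
apply: (ping_pong ltT lfT sgH _ _ fgH) => [x fx|h /HV hV x].
  by apply: nfo; exists x.
exact: (higman_thompson_good x hV).
Qed.
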